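(* Let $Z_1=V_2/V_1$, $Z_2=X_{a_1}/V_1$, $Z_3=X_{a_2}/V_1$, let $U\sim \mathrm{Gamma}(b-a+3,1)$ and let $\beta_2$ be the unique solution of $E L'(U\beta_2)=0$. If $\beta_2<c_{01}$, then the estimator $$\delta_{1S3}=\begin{cases}\min\{c_{01},\ \beta_2(1+Z_1+(n_1-a_1+1)Z_2+(n_2-a_2+1)Z_3)\}V_1, & Z_i>0,\ i=1,2,3,\\ c_{01}V_1, & \text{otherwise,}\end{cases}$$ of $\sigma_1$ dominates $\delta_{01}=c_{01}V_1$ under the scale invariant loss $L$.
   Context: Fix integers $1\le a_i<b_i\le n_i$, $i=1,2$, and put $a=a_1+a_2$, $b=b_1+b_2$. The unknown parameter is $\theta=(\mu_1,\mu_2,\sigma_1,\sigma_2)$ with $\mu_1,\mu_2\in\mathbb{R}$ and $0<\sigma_1\le\sigma_2$. From a random sample of size $n_i$ from the exponential distribution with density $\sigma_i^{-1}e^{-(x-\mu_i)/\sigma_i}$, $x>\mu_i$, one observes only the order statistics of ranks $a_i,\dots,b_i$ (doubly type-II censored sample). A complete sufficient statistic is $(X_{a_1},X_{a_2},V_1,V_2)$, consisting of four independent random variables, where $X_{a_i}$ has density $$\frac{n_i!}{(a_i-1)!(n_i-a_i)!}\Big[1-e^{-\frac{x-\mu_i}{\sigma_i}}\Big]^{a_i-1}\frac1{\sigma_i}\Big[e^{-\frac{x-\mu_i}{\sigma_i}}\Big]^{n_i-a_i+1},\quad x>\mu_i,$$ and $V_i$ has the gamma distribution with shape $b_i-a_i$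 and scale $\sigma_i$. $\mathrm{Gamma}(k,1)$ denotes the gamma distribution with shape $k$ and scale $1$. The loss for estimating $\sigma_1$ by $\delta$ is $L(\delta/\sigma_1)$, where $L$ is differentiable and: (i) $L(t)$ is bowl-shaped with minimum value $0$ attained at $t=1$, decreasing for $t\le1$ and increasing for $t\ge1$; (ii) all integrals involving $L$ are finite and differentiation under the integral sign is permissible. The risk is $R(\theta,\delta)=E_\theta L(\delta/\sigma_1)$. An estimator $\delta$ dominates $\delta'$ if $R(\theta,\delta)\le R(\theta,\delta')$ for all $\theta$, with strict inequality for at least one $\theta$. The best affine equivariant estimator (BAEE) of $\sigma_1$ is $\delta_{01}=c_{01}V_1$, where $c_{01}$ is the unique solution of $E_{\sigma_1=1}\big(L'(c_{01}V_1)V_1\big)=0$. *)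

(* Defs.v *)
From HB Require Import structures.
From mathcomp Require Import all_boot all_order all_algebra.
From mathcomp Require Import all_classical all_reals all_analysis.
Set Implicit Arguments.
Unset Strict Implicit.
Unset Printing Implicit Defensive.
Import Order.TTheory GRing.Theory Num.Theory.
Import numFieldNormedType.Exports.
Local Open Scope classical_set_scope.
Local Open Scope ring_scope.

Record param (R : realType) : Type := Param {
  mu1 : R; mu2 : R; sigma1 : R; sigma2 : R }.

Definition admissible (R : realType) (th : param R) : Prop :=
  0 < sigma1 th /\ sigma1 th <= sigma2 th.

(* Density of the order statistic of rank a in a sample of size n from the
   exponential distribution with location mu and scale sigma. *)
Definition ordstat_pdf (R : realType) (n a : nat) (mu sigma x : R) : R :=
  if mu < x then
    (n`!)%:R / ((a - 1)`!%:R * (n - a)`!%:R)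
    * (1 - expR (- ((x - mu) / sigma))) ^+ (a - 1)
    * sigma^-1 * expR (- ((x - mu) / sigma)) ^+ (n - a + 1)
  else 0.

(* Only positive integer shapes k are needed, so Gamma(k) is (k - 1)!. *)
Definition gamma_pdf (R : realType) (k : nat) (s x : R) : R :=
  if 0 < x then
    x ^+ (k - 1) * expR (- (x / s)) / ((k - 1)`!%:R * s ^+ k)
  else 0.

(* E f(W) for W ~ Gamma(k, 1); values of f off ]0, +oo[ play no role. *)
Definition gamma_mean (R : realType) (k : nat) (f : R -> R) : R :=
  \int[lebesgue_measure]_(x in `]0, +oo[) (f x * gamma_pdf k 1 x).

Definition gamma_integrable (R : realType) (k : nat) (f : R -> R) : Prop :=
  lebesgue_measure.-integrable `]0, +oo[
    (fun x : R => (f x * gamma_pdf k 1 x)%:E).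

Definition has_density d (T : measurableType d) (R : realType)
    (P : probability T R) (X : {mfun T >-> R}) (f : R -> R) : Prop :=
  forall A : set R, measurable A ->
    P (X @^-1` A) = (\int[lebesgue_measure]_(x in A) (f x)%:E)%E.

(* Mutual independence: the product rule for subfamilies is the case where
   some of the sets are setT. *)
Definition independent4 d (T : measurableType d) (R : realType)
    (P : probability T R) (X1 X2 X3 X4 : {mfun T >-> R}) : Prop :=
  forall A1 A2 A3 A4 : set R,
    measurable A1 -> measurable A2 -> measurable A3 -> measurable A4 ->
    P (X1 @^-1` A1 `&` X2 @^-1` A2 `&` X3 @^-1` A3 `&` X4 @^-1` A4) =
    (P (X1 @^-1` A1) * P (X2 @^-1` A2) * P (X3 @^-1` A3) * P (X4 @^-1` A4))%E.

(* The law of the sufficient statistic (X_{a_1}, X_{a_2}, V_1, V_2) under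
   every admissible parameter. *)
Definition censored_model d (T : measurableType d) (R : realType)
    (n1 a1 b1 n2 a2 b2 : nat) (P : param R -> probability T R)
    (X1 X2 V1 V2 : {mfun T >-> R}) : Prop :=
  forall th, admissible th ->
  [/\ has_density (P th) X1 (ordstat_pdf n1 a1 (mu1 th) (sigma1 th)),
      has_density (P th) X2 (ordstat_pdf n2 a2 (mu2 th) (sigma2 th)),
      has_density (P th) V1 (gamma_pdf (b1 - a1) (sigma1 th)),
      has_density (P th) V2 (gamma_pdf (b2 - a2) (sigma2 th))
    & independent4 (P th) X1 X2 V1 V2].

(* The loss lives on ]0, +oo[.  It is represented by a total function, whose
   values on ]-oo, 0] are arbitrary up to Borel measurability; the estimators
   below are almost surely positive.  Monotonicity is not required to be
   strict. *)
Definition bowl_shaped (R : realType) (L : R -> R) : Prop :=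
  [/\ measurable_fun setT L,
      forall t, 0 < t -> derivable L t 1,
      L 1 = 0,
      forall s t, 0 < s -> s <= t -> t <= 1 -> L t <= L s
    & forall s t, 1 <= s -> s <= t -> L s <= L t].

(* E L(cW) and E (L'(cW) W), W ~ Gamma(k, 1), are finite, and E L(cW) may be
   differentiated with respect to c under the expectation.  The shapes that
   occur are b_1 - a_1 (law of V_1 / sigma_1) and b - a + 2 (gamma kernel
   of the conditional law of V_1 given Z; since x * gamma_pdf k 1 x equals
   k * gamma_pdf k.+1 1 x, it also makes E L'(cU), U ~ Gamma(b - a + 3, 1),
   finite). *)
Definition regular_loss (R : realType) (k : nat) (L : R -> R) : Prop :=
  forall c : R, 0 < c ->
  [/\ gamma_integrable k (fun x => L (c * x)),
      gamma_integrable k (fun x => (L^`())%classic (c * x) * x)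
    & is_derive c (1 : R) (fun e : R => gamma_mean k (fun x => L (e * x)))
        (gamma_mean k (fun x => (L^`())%classic (c * x) * x))].

Definition unique_pos_root (R : realType) (f : R -> R) (c : R) : Prop :=
  [/\ 0 < c, f c = 0 & forall e, 0 < e -> f e = 0 -> e = c].

Definition risk d (T : measurableType d) (R : realType)
    (P : param R -> probability T R) (L : R -> R)
    (th : param R) (delta : T -> R) : \bar R :=
  expectation (P th) (fun w => L (delta w / sigma1 th)).

Definition dominates d (T : measurableType d) (R : realType)
    (P : param R -> probability T R) (L : R -> R)
    (delta delta' : T -> R) : Prop :=
  (forall th, admissible th ->
    (risk P L th delta <= risk P L th delta')%E) /\
  (exists2 th, admissible th &
    (risk P L th delta < risk P L th delta')%E).

Definition delta01 (T : Type) (R : realType) (c01 : R) (V1 : T -> R) (w : T)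
    : R := c01 * V1 w.

Definition delta1S3 (T : Type) (R : realType) (n1 a1 n2 a2 : nat)
    (c01 beta2 : R) (X1 X2 V1 V2 : T -> R) (w : T) : R :=
  let z1 := V2 w / V1 w in
  let z2 := X1 w / V1 w in
  let z3 := X2 w / V1 w in
  if [&& 0 < z1, 0 < z2 & 0 < z3] then
    Num.min c01 (beta2 * (1 + z1 + (n1 - a1 + 1)%:R * z2
                            + (n2 - a2 + 1)%:R * z3)) * V1 w
  else c01 * V1 w.

(* Main.v *)
Require Import Defs.
From HB Require Import structures.
From mathcomp Require Import all_boot all_order all_algebra.
From mathcomp Require Import all_classical all_reals all_analysis.
From mathcomp Require Import measurable_realfun ring lra zify.
Import Order.TTheory GRing.Theory Num.Theory.
Import numFieldNormedType.Exports.
Local Open Scope classical_set_scope.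
Local Open Scope ring_scope.

(* Every scale-equivariant estimator has the form phi(Z) V_1, and conditionally
   on Z = z > 0 the density of V_1 is, up to a constant, H(v) v^(b-a+1)
   exp(- S v / sigma_1), where S = 1 + z_1 + (n_1-a_1+1) z_2 + (n_2-a_2+1) z_3
   and H is nonnegative and nondecreasing (this is where sigma_1 <= sigma_2
   enters).  For H = 1 the conditional risk is increasing in the factor phi on
   [beta_2 S, oo[, by a monotone likelihood ratio argument; and
   L (c v) - L (c' v) with c' < c changes sign only once, from - to +, so that
   a nondecreasing weight H can only increase the gain.  Hence lowering c_01 to
   beta_2 S whenever beta_2 S < c_01 never increases the conditional risk, and
   it decreases it where H > 0, for instance at mu_1 = mu_2 = 0 on a small box
   of ratios z. *)

(** The shape in the equation for [beta2] comes from counting powers of [v]: the Jacobian [v ^+ 3]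
    and the two gamma densities leave the exponent [b - a + 1], a gamma kernel of shape [b - a + 2],
    and differentiating [L (c * v)] in [c] brings out one more [v], hence the shape [b - a + 3].
    Since [L] is only weakly monotone, strictness cannot be read off pointwise: it comes from the
    uniqueness of the root [beta2], which forbids the derivative of the risk to vanish again further
    to the right. Integrals over [v] against the weighted kernel are compared in the extended reals;
    the terms cancelled there are unweighted gamma means, finite by regularity of the loss. To turn
    a strict gain on a box of ratios into a strict inequality of risks, the risk of [c01 * V1] has
    to be finite at the chosen parameter; this is read off the law of [V1] alone. *)

(** * Laws with a density and product measures *)

(* The density agrees almost everywhere with the Radon-Nikodym derivative, for
   which the change of variables is in the library. *)
Lemma ge0_integral_density d (T : measurableType d) (R : realType)
    (mu : {sigma_finite_measure set T -> \bar R})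
    (nu : {finite_measure set T -> \bar R}) (f : T -> R) (G : T -> \bar R) :
  measurable_fun setT f -> (forall t, 0 <= f t) ->
  (forall A, measurable A -> nu A = (\int[mu]_(t in A) (f t)%:E)%E) ->
  measurable_fun setT G -> (forall t, 0 <= G t)%E ->
  (\int[nu]_t G t = \int[mu]_t (G t * (f t)%:E))%E.
Proof.
move=> mf f0 nuE mG G0.
have mfE : measurable_fun setT (EFin \o f) by exact/measurable_EFinP.
have numu : nu `<< mu.
  apply/null_content_dominatesP => A mA A0; rewrite nuE//.
  apply: null_set_integral => //; exact: measurable_funTS.
pose g := Radon_Nikodym_SigmaFinite.f nu mu.
have ig : mu.-integrable setT g := Radon_Nikodym_SigmaFinite.f_integrable numu.
have mg : measurable_fun setT g by case/integrableP : ig.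
have [N [mN N0 sN]] : ae_eq mu setT g (EFin \o f).
  apply: (integral_ae_eq measurableT ig mfE) => A _ mA.
  by rewrite -Radon_Nikodym_SigmaFinite.f_integral// nuE.
rewrite -(Radon_Nikodym_SigmaFinite.change_of_variables numu)//.
apply: ge0_ae_eq_integral => //.
- exact: emeasurable_funM.
- exact: emeasurable_funM.
- by move=> x _; rewrite mule_ge0// Radon_Nikodym_SigmaFinite.f_ge0.
- by move=> x _; rewrite mule_ge0// lee_fin.
exists N; split => //; apply: subset_trans sN; apply: subsetC => x h Tx.
by congr (_ * _)%E; exact: h.
Qed.

Section product_sigma_finite.
Context {d1 d2} {T1 : measurableType d1} {T2 : measurableType d2}.
Context {R : realType}.
Variable m1 : {sigma_finite_measure set T1 -> \bar R}.
Variable m2 : {sigma_finite_measure set T2 -> \bar R}.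

Let product_sigma_finite : sigma_finite setT (m1 \x m2)%E.
Proof.
have /sigma_finiteP[F [UF ndF Ffin]] := sigma_finiteT m1.
have /sigma_finiteP[G [UG ndG Gfin]] := sigma_finiteT m2.
exists (fun n => F n `*` G n).
  apply/seteqP; split=> // -[x y] _.
  have [i _ Fx] : (\bigcup_n F n) x by rewrite -UF.
  have [j _ Gy] : (\bigcup_n G n) y by rewrite -UG.
  exists (i + j)%N => //; split => /=.
    by move: x Fx; exact/subsetPset/ndF/leq_addr.
  by move: y Gy; exact/subsetPset/ndG/leq_addl.
move=> n; have [mF Fn] := Ffin n; have [mG Gn] := Gfin n.
split; first exact: measurableX.
by rewrite product_measure1E// lte_mul_pinfty// ge0_fin_numE.
Qed.

(* MathComp-Analysis infers a sigma-finite structure on [m1 \x m2] only when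
   both measures are finite. *)
Definition sigma_finite_prod :
    {sigma_finite_measure set (T1 * T2)%type -> \bar R} :=
  HB.pack (m1 \x m2)%E
    (Measure_isSigmaFinite.Build _ _ _ (m1 \x m2)%E product_sigma_finite).

Lemma sigma_finite_prodE (A : set T1) (B : set T2) :
  measurable A -> measurable B ->
  sigma_finite_prod (A `*` B) = (m1 A * m2 B)%E.
Proof. exact: product_measure1E. Qed.

Lemma ge0_integral_sigma_finite_prod (f : T1 * T2 -> \bar R) :
  measurable_fun setT f -> (forall z, 0 <= f z)%E ->
  (\int[sigma_finite_prod]_z f z = \int[m1]_x \int[m2]_y f (x, y))%E.
Proof. exact: fubini_tonelli1. Qed.

End product_sigma_finite.

(** Densities are tested on nonnegative functions rather than on sets, so that joint laws can be
    assembled one factor at a time by Tonelli and then inserted directly into a risk integral. *)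
Definition law_density {d} {T : measurableType d} {R : realType}
    (P : probability T R) {d'} {S : measurableType d'}
    (mu : {measure set S -> \bar R}) (X : T -> S) (f : S -> R) : Prop :=
  forall G : S -> \bar R, measurable_fun setT G -> (forall s, 0 <= G s)%E ->
    (\int[P]_w G (X w) = \int[mu]_s (G s * (f s)%:E))%E.

(* [lebesgue_measure] lives on [measurableTypeR R], whose display differs from
   that of the canonical measurable structure of [R]. *)
Definition mfun_leb {d} {T : measurableType d} {R : realType}
    (X : {mfun T >-> R}) : {mfun T >-> measurableTypeR R} :=
  HB.pack (X : T -> measurableTypeR R)
    (isMeasurableFun.Build _ _ _ _ (X : T -> measurableTypeR R)
      (measurable_funP X)).

Lemma has_density_law d (T : measurableType d) (R : realType)
    (P : probability T R) (X : {mfun T >-> R}) (f : R -> R) :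
  measurable_fun setT f -> (forall x, 0 <= f x) -> has_density P X f ->
  law_density P lebesgue_measure X f.
Proof.
move=> mf f0 hX G mG G0.
rewrite -(ge0_integral_distribution (mfun_leb X))//.
exact: ge0_integral_density.
Qed.

(** Independence identifies the joint law with the product of the two laws, by uniqueness of the
    product measure; Tonelli then inserts the densities one coordinate at a time. *)
Lemma law_density_pair d (T : measurableType d) (R : realType)
    (P : probability T R) d1 (S1 : measurableType d1)
    d2 (S2 : measurableType d2)
    (X : {mfun T >-> S1}) (Y : {mfun T >-> S2})
    (mu : {sigma_finite_measure set S1 -> \bar R})
    (nu : {sigma_finite_measure set S2 -> \bar R}) (f : S1 -> R) (g : S2 -> R) :
  (forall A B, measurable A -> measurable B ->
    P (X @^-1` A `&` Y @^-1` B) = (P (X @^-1` A) * P (Y @^-1` B))%E) ->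
  measurable_fun setT f -> (forall x, 0 <= f x) ->
  measurable_fun setT g -> (forall x, 0 <= g x) ->
  law_density P mu X f -> law_density P nu Y g ->
  law_density P (sigma_finite_prod mu nu) (fun w => (X w, Y w))
    (fun s => f s.1 * g s.2).
Proof.
move=> XY mf f0 mg g0 lX lY G mG G0.
have mXY : measurable_fun setT (fun w => (X w, Y w)).
  by apply: measurable_fun_pair; exact: measurable_funP.
have := @ge0_integral_pushforward _ _ _ _ _ _ mXY P setT G measurableT mG.
move=> /(_ (fun _ _ => G0 _)); rewrite preimage_setT => <-.
pose PX := distribution P X; pose PY := distribution P Y.
rewrite [LHS](@eq_measure_integral _ _ _ _ (PX \x PY)%E); last first.
  move=> A mA _; apply/esym; apply: product_measure_unique => // B C mB mC.
rewrite fubini_tonelli1//.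
have mf' : measurable_fun setT (fun s : S1 * S2 => f s.1).
  by apply: (measurableT_comp mf); exact: measurable_fst.
have mg' : measurable_fun setT (fun s : S1 * S2 => g s.2).
  by apply: (measurableT_comp mg); exact: measurable_snd.
have mGg : measurable_fun setT (fun s => G s * (g s.2)%:E)%E.
  by apply: emeasurable_funM => //; exact/measurable_EFinP.
have secE x : fubini_F PY G x = fubini_F nu (fun s => G s * (g s.2)%:E)%E x.
  rewrite /fubini_F -(lY (fun y => G (x, y)))//; last first.
    exact/measurable_fun_pair2.
  rewrite ge0_integral_distribution//.
  exact/measurable_fun_pair2.
rewrite (eq_integral (fubini_F nu (fun s => G s * (g s.2)%:E)%E)); last first.
  by move=> x _; exact: secE.
have mF : measurable_fun setT (fubini_F nu (fun s => G s * (g s.2)%:E)%E).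
  apply: measurable_fun_fubini_tonelli_F => // s.
  by rewrite mule_ge0// lee_fin.
have F0 x : (0 <= fubini_F nu (fun s => G s * (g s.2)%:E)%E x)%E.
  by apply: integral_ge0 => y _; rewrite mule_ge0// lee_fin.
rewrite [LHS]ge0_integral_distribution// lX//.
rewrite ge0_integral_sigma_finite_prod//; last 2 first.
  - apply: emeasurable_funM => //; apply/measurable_EFinP.
    exact: measurable_funM.
  - by move=> s; rewrite mule_ge0// lee_fin mulr_ge0.
apply: eq_integral => x _; rewrite /fubini_F.
rewrite -ge0_integralZr//.
- apply: eq_integral => y _ /=.
  by rewrite EFinM -muleA [(_%:E * (f x)%:E)%E]muleC.
- exact: (measurable_fun_pair2 x mGg).
- by move=> y _; rewrite mule_ge0// lee_fin.
- by rewrite lee_fin.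
Qed.

(** In [C], both sides are finite measures; they agree on rectangles, which form a pi-system
    generating the product sigma-algebra. *)
Lemma indep_pair d (T : measurableType d) (R : realType) (P : probability T R)
    d1 (S1 : measurableType d1) d2 (S2 : measurableType d2)
    (E : set T) (X : {mfun T >-> S1}) (Y : {mfun T >-> S2}) :
  measurable E ->
  (forall A B, measurable A -> measurable B ->
    P (E `&` (X @^-1` A `&` Y @^-1` B)) =
    (P E * P (X @^-1` A `&` Y @^-1` B))%E) ->
  forall C : set (S1 * S2), measurable C ->
    P (E `&` (fun w => (X w, Y w)) @^-1` C) =
    (P E * P ((fun w => (X w, Y w)) @^-1` C))%E.
Proof.
move=> mE EXY.
have mXY : measurable_fun setT (fun w => (X w, Y w)).
  by apply: measurable_fun_pair; exact: measurable_funP.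
pose XY : {mfun T >-> (S1 * S2)%type} :=
  HB.pack (fun w => (X w, Y w)) (isMeasurableFun.Build _ _ _ _ _ mXY).
pose r : {nonneg R} := NngNum (fine_ge0 (measure_ge0 P E)).
have [m1 m1E] : exists m1 : {measure set (S1 * S2) -> \bar R},
    forall C, m1 C = P (XY @^-1` C `&` E).
  by unshelve eexists (pushforward (mrestr P mE) XY).
have rE : r%:num%:E = P E by rewrite fineK// fin_num_measure.
pose m2 : {measure set (S1 * S2) -> \bar R} := mscale r (distribution P XY).
move=> C mC.
have m2E B : m2 B = (P E * P (XY @^-1` B))%E by rewrite -rE.
suff : m1 C = m2 C by rewrite m1E m2E setIC.
apply: (measure_unique [set A `*` B | A in measurable & B in measurable]
   (fun=> setT)) => //.
- exact: measurable_prod_measurableType.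
- move=> _ _ [A mA [B mB <-]] [A' mA' [B' mB' <-]].
  exists (A `&` A'); first exact: measurableI.
  by exists (B `&` B'); [exact: measurableI|rewrite setXI].
- by move=> _; exists setT => //; exists setT => //; rewrite setXTT.
- by rewrite bigcup_const//; exists 0%N.
- move=> _ [A mA [B mB <-]].
  rewrite m1E m2E setIC; exact: EXY.
- move=> _; rewrite m1E preimage_setT setTI.
  by rewrite -ge0_fin_numE// fin_num_measure.
Qed.

Section lebesgue_product.
Context {R : realType}.
Let RR : measurableType _ := measurableTypeR R.

Definition leb : {sigma_finite_measure set RR -> \bar R} := @lebesgue_measure R.
Definition leb2 : {sigma_finite_measure set (RR * RR)%type -> \bar R} :=
  sigma_finite_prod leb leb.
Definition leb3 : {sigma_finite_measure set (RR * (RR * RR))%type -> \bar R} :=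
  sigma_finite_prod leb leb2.
Definition leb4 :
    {sigma_finite_measure set (RR * (RR * (RR * RR)))%type -> \bar R} :=
  sigma_finite_prod leb leb3.

End lebesgue_product.

(** The tuple is built from the inside out, [indep_pair] making each new variable independent of the
    tuple already formed. [X3], to be instantiated by [V_1], comes first, so that the remaining
    coordinates form the block that is rescaled by it. *)
Lemma independent4_law_density d (T : measurableType d) (R : realType)
    (P : probability T R) (X1 X2 X3 X4 : {mfun T >-> R})
    (f1 f2 f3 f4 : R -> R) :
  independent4 P X1 X2 X3 X4 ->
  measurable_fun setT f1 -> (forall x, 0 <= f1 x) -> has_density P X1 f1 ->
  measurable_fun setT f2 -> (forall x, 0 <= f2 x) -> has_density P X2 f2 ->
  measurable_fun setT f3 -> (forall x, 0 <= f3 x) -> has_density P X3 f3 ->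
  measurable_fun setT f4 -> (forall x, 0 <= f4 x) -> has_density P X4 f4 ->
  law_density P leb4 (fun w => (X3 w, (X4 w, (X1 w, X2 w))))
    (fun s => f3 s.1 * (f4 s.2.1 * (f1 s.2.2.1 * f2 s.2.2.2))).
Proof.
move=> ind mf1 p1 h1 mf2 p2 h2 mf3 p3 h3 mf4 p4 h4.
have mX (X : {mfun T >-> R}) A : measurable A -> measurable (X @^-1` A).
  by move=> mA; rewrite -[_ @^-1` _]setTI; exact: measurable_funP.
have m12 : measurable_fun setT
    (fun w => (X1 w : measurableTypeR R, X2 w : measurableTypeR R)).
  apply: measurable_fun_pair; first exact: (measurable_funP (mfun_leb X1)).
  exact: (measurable_funP (mfun_leb X2)).
pose X12 : {mfun T >-> (measurableTypeR R * measurableTypeR R)%type} :=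
  HB.pack (fun w => (X1 w, X2 w)) (isMeasurableFun.Build _ _ _ _ _ m12).
have m412 : measurable_fun setT (fun w => (X4 w : measurableTypeR R, X12 w)).
  apply: measurable_fun_pair; first exact: (measurable_funP (mfun_leb X4)).
  exact: m12.
pose X412 : {mfun T >->
    (measurableTypeR R * (measurableTypeR R * measurableTypeR R))%type} :=
  HB.pack (fun w => (X4 w, X12 w)) (isMeasurableFun.Build _ _ _ _ _ m412).
have mX12 C : measurable C -> measurable (X12 @^-1` C).
  by move=> mC; rewrite -[_ @^-1` _]setTI; exact: (measurable_funP X12).
have ind12 A B : measurable A -> measurable B ->
    P (X1 @^-1` A `&` X2 @^-1` B) = (P (X1 @^-1` A) * P (X2 @^-1` B))%E.
  move=> mA mB; have := ind A B setT setT mA mB measurableT measurableT.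
  by rewrite !preimage_setT !setIT probability_setT !mule1.
have ind34 A B : measurable A -> measurable B ->
    P (X3 @^-1` A `&` X4 @^-1` B) = (P (X3 @^-1` A) * P (X4 @^-1` B))%E.
  move=> mA mB; have := ind setT setT A B measurableT measurableT mA mB.
  by rewrite !preimage_setT !setTI probability_setT !mul1e.
(* The events on [X3] and [X4] are kept together: [A := setT] gives the independence of [X4] and
   [X12], and a general [A] gives the product rule of [X3] against rectangles in [X4] and [X12]. *)
have ind34_12 A B C : measurable A -> measurable B -> measurable C ->
    P ((X3 @^-1` A `&` X4 @^-1` B) `&` X12 @^-1` C) =
    (P (X3 @^-1` A `&` X4 @^-1` B) * P (X12 @^-1` C))%E.
  move=> mA mB mC; apply: indep_pair => //.
    by apply: measurableI; exact: mX.
  move=> A' B' mA' mB'; rewrite ind34// ind12// setIC setIA ind// -!muleA.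
  by rewrite muleA muleC -!muleA.
have ind4_12 B C : measurable B -> measurable C ->
    P (X4 @^-1` B `&` X12 @^-1` C) = (P (X4 @^-1` B) * P (X12 @^-1` C))%E.
  move=> mB mC; have := ind34_12 setT B C measurableT mB mC.
  by rewrite preimage_setT setTI.
apply: (@law_density_pair _ _ _ _ _ _ _ _ (mfun_leb X3) X412 _ _ f3
  (fun s => f4 s.1 * (f1 s.2.1 * f2 s.2.2))) => //.
- move=> A D mA mD; apply: indep_pair => //; first exact: mX.
  by move=> B C mB mC; rewrite setIA ind34_12// ind34// ind4_12// muleA.
- apply: measurable_funM.
    by apply: (measurableT_comp mf4); exact: measurable_fst.
  apply: measurable_funM.
    apply: (measurableT_comp mf1); apply: (measurableT_comp measurable_fst).
    exact: measurable_snd.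
  apply: (measurableT_comp mf2); apply: (measurableT_comp measurable_snd).
  exact: measurable_snd.
- by move=> s; rewrite !mulr_ge0.
- exact: has_density_law.
apply: (@law_density_pair _ _ _ _ _ _ _ _ (mfun_leb X4) X12 _ _ f4
  (fun s => f1 s.1 * f2 s.2)) => //.
- apply: measurable_funM.
    by apply: (measurableT_comp mf1); exact: measurable_fst.
  by apply: (measurableT_comp mf2); exact: measurable_snd.
- by move=> s; rewrite !mulr_ge0.
- exact: has_density_law.
apply: (@law_density_pair _ _ _ _ _ _ _ _ (mfun_leb X1) (mfun_leb X2)) => //;
  exact: has_density_law.
Qed.

(** The image of Lebesgue measure under [x |-> v * x], multiplied by [v], gives half-open intervals
    their length, hence is Lebesgue measure. *)
Lemma ge0_integral_leb_scale (R : realType) (v : R)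
    (F : measurableTypeR R -> \bar R) :
  0 < v -> measurable_fun setT F -> (forall x, 0 <= F x)%E ->
  (\int[leb]_x F x = v%:E * \int[leb]_x F (v * x)%R)%E.
Proof.
move=> v0 mF F0.
pose s : measurableTypeR R -> measurableTypeR R := fun x => v * x.
have ms : measurable_fun setT s by exact: mulrl_measurable.
have [nu nuE] : exists nu : {measure set (measurableTypeR R) -> \bar R},
    forall A, nu A = pushforward leb s A.
  by unshelve eexists (pushforward leb s).
have v0' : 0 <= v by exact: ltW.
transitivity (\int[mscale (NngNum v0') nu]_x F x)%E.
  apply: eq_measure_integral => A mA _.
  apply: lebesgue_measure_unique => // _ [[a b] _ <-].
  rewrite /= /mscale /= nuE /pushforward.
  have -> : s @^-1` `]a, b] = [set` `]a / v, b / v]].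
    apply/seteqP; split => x /=; rewrite !in_itv/= /s.
      by rewrite ltr_pdivrMr// ler_pdivlMr// mulrC.
    by rewrite ltr_pdivrMr// ler_pdivlMr// mulrC.
  rewrite /leb /= !lebesgue_measure_itv/= !lte_fin ltr_pM2r ?invr_gt0//.
  case: ifPn => _; last by rewrite mule0.
  by rewrite -!EFinB -EFinM -mulrBl mulrCA divff ?gt_eqF// mulr1.
rewrite ge0_integral_mscale//; congr (_ * _)%E.
rewrite (@eq_measure_integral _ _ _ _ (pushforward leb s)); last first.
  by move=> A _ _; exact: nuE.
by rewrite (ge0_integral_pushforward ms)// preimage_setT.
Qed.

(** Arbitrary maps with constant Jacobians are allowed so that the lemma can be fed its own
    conclusion: dimension 2 first, then dimension 3. *)
Lemma ge0_integral_prod_scale {d1 d2} {T1 : measurableType d1}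
    {T2 : measurableType d2} {R : realType}
    {m1 : {sigma_finite_measure set T1 -> \bar R}}
    {m2 : {sigma_finite_measure set T2 -> \bar R}}
    {s1 : T1 -> T1} {s2 : T2 -> T2} {c1 c2 : R} :
  0 <= c1 -> 0 <= c2 -> measurable_fun setT s1 -> measurable_fun setT s2 ->
  (forall F, measurable_fun setT F -> (forall x, 0 <= F x)%E ->
    (\int[m1]_x F x = c1%:E * \int[m1]_x F (s1 x))%E) ->
  (forall F, measurable_fun setT F -> (forall x, 0 <= F x)%E ->
    (\int[m2]_x F x = c2%:E * \int[m2]_x F (s2 x))%E) ->
  forall F, measurable_fun setT F -> (forall x, 0 <= F x)%E ->
    (\int[sigma_finite_prod m1 m2]_x F x = (c1 * c2)%:E *
     \int[sigma_finite_prod m1 m2]_x F (s1 x.1, s2 x.2))%E.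
Proof.
move=> c10 c20 ms1 ms2 h1 h2 F mF F0.
have mFs2 : measurable_fun setT (fun z => F (z.1, s2 z.2)).
  apply: (measurableT_comp mF); apply: measurable_fun_pair => //=.
  by apply: (measurableT_comp ms2); exact: measurable_snd.
have mFs12 : measurable_fun setT (fun z => F (s1 z.1, s2 z.2)).
  apply: (measurableT_comp mF); apply: measurable_fun_pair => //=.
    by apply: (measurableT_comp ms1); exact: measurable_fst.
  by apply: (measurableT_comp ms2); exact: measurable_snd.
rewrite !ge0_integral_sigma_finite_prod//.
have mG : measurable_fun setT (fun x => \int[m2]_y F (x, s2 y))%E.
  by apply: (@measurable_fun_fubini_tonelli_F _ _ _ _ _ m2
    (fun z => F (z.1, s2 z.2))).
transitivity (\int[m1]_x (c2%:E * \int[m2]_y F (x, s2 y)))%E.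
  apply: eq_integral => x _; apply: (h2 (fun y => F (x, y))) => //.
  exact/measurable_fun_pair2.
rewrite ge0_integralZl//; last by move=> x _; exact: integral_ge0.
rewrite (h1 _ mG); last by move=> x; exact: integral_ge0.
by rewrite muleA -EFinM mulrC.
Qed.

Lemma ge0_integral_leb3_scale (R : realType) (v : R)
    (F : measurableTypeR R * (measurableTypeR R * measurableTypeR R) ->
         \bar R) :
  0 < v -> measurable_fun setT F -> (forall x, 0 <= F x)%E ->
  (\int[leb3]_z F z =
   (v ^+ 3)%:E * \int[leb3]_z F (v * z.1, (v * z.2.1, v * z.2.2))%R)%E.
Proof.
move=> v0 mF F0.
have ms : measurable_fun setT
    (fun x : measurableTypeR R => v * x : measurableTypeR R).
  exact: mulrl_measurable.
have ms2 : measurable_fun setT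
   (fun x : (measurableTypeR R * measurableTypeR R)%type =>
    (v * x.1 : measurableTypeR R, v * x.2 : measurableTypeR R)).
  apply: measurable_fun_pair => /=.
    by apply: (measurableT_comp ms); exact: measurable_fst.
  by apply: (measurableT_comp ms); exact: measurable_snd.
have s1 := @ge0_integral_leb_scale R v ^~ v0.
have v0' : 0 <= v by exact: ltW.
have s2 := ge0_integral_prod_scale v0' v0' ms ms s1 s1.
have s3 := ge0_integral_prod_scale v0' (mulr_ge0 v0' v0') ms ms2 s1 s2.
by rewrite /leb3 s3// exprS expr2.
Qed.

(** * Risk of scale-equivariant estimators *)

(** Squaring makes the base of the real power nonnegative, and the extra factor [x] restores the
    sign; at 0 both expressions are 0. *)
Lemma measurable_invr (R : realType) : measurable_fun [set: R] (@GRing.inv R).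
Proof.
have -> : @GRing.inv R = (fun x => x * (x ^+ 2) `^ (-1)).
  apply/funext => x; rewrite powR_inv1 ?sqr_ge0//.
  have [->|x0] := eqVneq x 0; first by rewrite invr0 mul0r.
  by rewrite expr2 invfM mulrA divff// mul1r.
apply: measurable_funM => //.
have mp := @measurable_powR R (-1).
apply: (measurableT_comp mp).
exact: exprn_measurable.
Qed.

Lemma gamma_pdf_ge0 (R : realType) (k : nat) (s x : R) :
  0 < s -> 0 <= gamma_pdf k s x.
Proof.
move=> s0; rewrite /gamma_pdf; case: ifPn => // x0.
rewrite divr_ge0// ?mulr_ge0 ?expR_ge0 ?exprn_ge0 ?ler0n//; exact: ltW.
Qed.

Lemma measurable_gamma_pdf (R : realType) (k : nat) (s : R) :
  measurable_fun setT (gamma_pdf k s).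
Proof.
apply: measurable_fun_ifT.
- exact: measurable_fun_ltr.
- apply: measurable_funM => //; apply: measurable_funM => //.
  apply: (measurableT_comp (@measurable_expR R)).
  apply: measurable_funN; exact: measurable_funM.
- exact: measurable_cst.
Qed.

Lemma ordstat_pdf_ge0 (R : realType) (n a : nat) (mu s x : R) :
  0 < s -> 0 <= ordstat_pdf n a mu s x.
Proof.
move=> s0; rewrite /ordstat_pdf; case: ifPn => // mux.
rewrite !mulr_ge0 ?invr_ge0 ?mulr_ge0 ?ler0n ?exprn_ge0 ?expR_ge0//;
  last exact: ltW.
by rewrite subr_ge0 expR_le1 oppr_le0 divr_ge0 ?subr_ge0 ?ltW.
Qed.

Lemma measurable_ordstat_pdf (R : realType) (n a : nat) (mu s : R) :
  measurable_fun setT (ordstat_pdf n a mu s).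
Proof.
have me : measurable_fun setT (fun x : R => expR (- ((x - mu) / s))).
  apply: (measurableT_comp (@measurable_expR R)).
  apply: measurable_funN; apply: measurable_funM => //; exact: measurable_funB.
apply: measurable_fun_ifT.
- exact: measurable_fun_ltr.
- apply: measurable_funM; last exact: measurable_funX.
  apply: measurable_funM => //; apply: measurable_funM => //.
  by apply: measurable_funX; exact: measurable_funB.
- exact: measurable_cst.
Qed.

Lemma measurable_prod4 (R : realType) (f1 f2 f3 f4 : measurableTypeR R -> R) :
  measurable_fun setT f1 -> measurable_fun setT f2 ->
  measurable_fun setT f3 -> measurable_fun setT f4 ->
  measurable_fun setT
    (fun s : measurableTypeR R * (measurableTypeR R *
       (measurableTypeR R * measurableTypeR R)) =>
      f1 s.1 * (f2 s.2.1 * (f3 s.2.2.1 * f4 s.2.2.2))).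
Proof.
move=> m1 m2 m3 m4.
apply: measurable_funM.
  by apply: (measurableT_comp m1); exact: measurable_fst.
apply: measurable_funM.
  apply: (measurableT_comp m2); apply: (measurableT_comp measurable_fst).
  exact: measurable_snd.
apply: measurable_funM.
  apply: (measurableT_comp m3); apply: (measurableT_comp measurable_fst).
  by apply: (measurableT_comp measurable_snd); exact: measurable_snd.
apply: (measurableT_comp m4); apply: (measurableT_comp measurable_snd).
by apply: (measurableT_comp measurable_snd); exact: measurable_snd.
Qed.

(* The part of the loss that matters: estimators are almost surely positive. *)
Definition pos_loss {R : realType} (L : R -> R) (t : R) : R :=
  if 0 < t then L t else 0.

Lemma pos_loss_ge0 {R : realType} {L : R -> R} :
  bowl_shaped L -> forall t, 0 <= pos_loss L t.
Proof.
move=> [_ _ L1 Ld Li] t; rewrite /pos_loss; case: ifPn => // t0.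
rewrite -L1; have [t1|/ltW t1] := leP t 1; first exact: Ld.
exact: Li.
Qed.

Lemma measurable_pos_loss {R : realType} {L : R -> R} :
  bowl_shaped L -> measurable_fun setT (pos_loss L).
Proof.
move=> [mL _ _ _ _]; apply: measurable_fun_ifT => //.
exact: measurable_fun_ltr.
Qed.

(* Density of (V_1, V_2, X_1, X_2) at v (1, z_1, z_2, z_3), times the Jacobian
   v^3 of the passage to ratios. *)
Definition ratio_kernel {R : realType} (n1 a1 b1 n2 a2 b2 : nat) (th : param R)
    (z : R * (R * R)) (v : R) : R :=
  v ^+ 3 * (gamma_pdf (b1 - a1) (sigma1 th) v *
    (gamma_pdf (b2 - a2) (sigma2 th) (v * z.1) *
      (ordstat_pdf n1 a1 (mu1 th) (sigma1 th) (v * z.2.1) *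
       ordstat_pdf n2 a2 (mu2 th) (sigma2 th) (v * z.2.2)))).

Section risk_formula.
Context {d} {T : measurableType d} {R : realType}.
Variables (n1 a1 b1 n2 a2 b2 : nat) (P : param R -> probability T R).
Variables (X1 X2 V1 V2 : {mfun T >-> R}).
Hypothesis hmodel : censored_model n1 a1 b1 n2 a2 b2 P X1 X2 V1 V2.
Variable L : R -> R.
Hypothesis hL : bowl_shaped L.
Let RR : measurableType _ := measurableTypeR R.
Variable th : param R.
Hypothesis hth : admissible th.

Lemma censored_V1_gt0 : P th (V1 @^-1` `]-oo, 0]) = 0%E.
Proof.
have [_ _ hV1 _ _] := hmodel th hth; rewrite hV1//.
rewrite integral0_eq// => x /=; rewrite in_itv/= => x0.
by rewrite /gamma_pdf ltNge x0.
Qed.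

Let s10 : 0 < sigma1 th. Proof. by case: hth. Qed.

Let s20 : 0 < sigma2 th. Proof. by case: hth => ? /(lt_le_trans _); apply. Qed.

(** The two losses differ only on the null event [V_1 <= 0], and [pos_loss] is nonnegative
    everywhere, as Tonelli requires. *)
Lemma risk_pos_loss (delta : T -> R) : measurable_fun setT delta ->
  (forall w, 0 < V1 w -> 0 < delta w) ->
  risk P L th delta =
  (\int[P th]_w (pos_loss L (delta w / sigma1 th))%:E)%E.
Proof.
move=> mdelta delta0.
have mds : measurable_fun setT (fun w => delta w / sigma1 th).
  exact: measurable_funM.
rewrite /risk unlock; apply: ae_eq_integral => //.
- apply/measurable_EFinP; apply: (measurableT_comp _ mds).
  by case: hL.
- apply/measurable_EFinP; apply: (measurableT_comp _ mds).
  exact: measurable_pos_loss.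
exists (V1 @^-1` `]-oo, 0]); split.
- by rewrite -[X in measurable X]setTI; exact: measurable_funP.
- exact: censored_V1_gt0.
move=> w /= /not_implyP[_ h]; rewrite in_itv/= leNgt; apply/negP => V10.
by apply: h; rewrite /pos_loss ifT// divr_gt0// delta0.
Qed.

Variable phi : RR * (RR * RR) -> R.
Hypothesis mphi : measurable_fun setT phi.

Definition ratio_integrand (vz : RR * (RR * (RR * RR))) : \bar R :=
  ((pos_loss L (phi vz.2 * vz.1 / sigma1 th))%:E *
   (ratio_kernel n1 a1 b1 n2 a2 b2 th vz.2 vz.1)%:E)%E.

Let dens (s : RR * (RR * (RR * RR))) : R :=
  gamma_pdf (b1 - a1) (sigma1 th) s.1 *
  (gamma_pdf (b2 - a2) (sigma2 th) s.2.1 *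
   (ordstat_pdf n1 a1 (mu1 th) (sigma1 th) s.2.2.1 *
    ordstat_pdf n2 a2 (mu2 th) (sigma2 th) s.2.2.2)).

Let mdens : measurable_fun setT dens.
Proof.
by apply: measurable_prod4;
  [exact: measurable_gamma_pdf|exact: measurable_gamma_pdf|
   exact: measurable_ordstat_pdf|exact: measurable_ordstat_pdf].
Qed.

Let dens_ge0 s : 0 <= dens s.
Proof. by rewrite !mulr_ge0 ?gamma_pdf_ge0 ?ordstat_pdf_ge0. Qed.

Let m1 : measurable_fun setT (fun s : RR * (RR * (RR * RR)) => s.1 : R).
Proof. exact: measurable_fst. Qed.

Let m2 : measurable_fun setT (fun s : RR * (RR * (RR * RR)) => s.2.1 : R).
Proof. by apply: (measurableT_comp measurable_fst); exact: measurable_snd. Qed.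

Let m22 : measurable_fun setT (fun s : RR * (RR * (RR * RR)) => s.2.2).
Proof. by apply: (measurableT_comp measurable_snd); exact: measurable_snd. Qed.

Let m3 : measurable_fun setT (fun s : RR * (RR * (RR * RR)) => s.2.2.1 : R).
Proof. by apply: (measurableT_comp measurable_fst). Qed.

Let m4 : measurable_fun setT (fun s : RR * (RR * (RR * RR)) => s.2.2.2 : R).
Proof. by apply: (measurableT_comp measurable_snd). Qed.

Let mkernel : measurable_fun setT (fun vz : RR * (RR * (RR * RR)) =>
  ratio_kernel n1 a1 b1 n2 a2 b2 th vz.2 vz.1).
Proof.
rewrite /ratio_kernel; apply: measurable_funM; first exact: measurable_funX.
have ms : measurable_fun setT (fun s : RR * (RR * (RR * RR)) =>
    (s.1, (s.1 * s.2.1 : RR, (s.1 * s.2.2.1 : RR, s.1 * s.2.2.2 : RR)))).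
  apply: measurable_fun_pair => //.
  apply: measurable_fun_pair; first exact: (measurable_funM m1 m2).
  apply: measurable_fun_pair; first exact: (measurable_funM m1 m3).
  exact: (measurable_funM m1 m4).
exact: (measurableT_comp mdens ms).
Qed.

Lemma measurable_ratio_kernel (z : RR * (RR * RR)) : measurable_fun setT
  (fun v : RR => ratio_kernel n1 a1 b1 n2 a2 b2 th z v).
Proof. exact: (measurable_fun_pair1 z mkernel). Qed.

Lemma ratio_kernel_ge0 z v : 0 <= ratio_kernel n1 a1 b1 n2 a2 b2 th z v.
Proof.
have [v0|v0] := leP v 0.
  by rewrite /ratio_kernel {1}/gamma_pdf ltNge v0/= mul0r mulr0.
by rewrite !mulr_ge0 ?gamma_pdf_ge0 ?ordstat_pdf_ge0 ?(ltW v0).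
Qed.

Lemma measurable_ratio_integrand : measurable_fun setT ratio_integrand.
Proof.
apply: emeasurable_funM; apply/measurable_EFinP => //.
apply: (measurableT_comp (measurable_pos_loss hL)).
apply: measurable_funM => //.
apply: measurable_funM => //; apply: (measurableT_comp mphi).
exact: measurable_snd.
Qed.

Lemma ratio_integrand_ge0 vz : (0 <= ratio_integrand vz)%E.
Proof. by rewrite mule_ge0// lee_fin ?pos_loss_ge0 ?ratio_kernel_ge0. Qed.

(* Substituting [y = v z] and exchanging the integrals amounts to conditioning
   on the scale-free ratios [z]. *)
Lemma risk_equivariant (delta : T -> R) :
  (forall z, 0 < phi z) -> measurable_fun setT delta ->
  (forall w, 0 < V1 w ->
    delta w = phi (V2 w / V1 w, (X1 w / V1 w, X2 w / V1 w)) * V1 w) ->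
  risk P L th delta = (\int[leb3]_z \int[leb]_v ratio_integrand (v, z))%E.
Proof.
move=> phi0 mdelta deltaE.
have [hX1 hX2 hV1 hV2 hind] := hmodel th hth.
have law := independent4_law_density _ _ _ _ _ _ _ _ _ _ _ _ hind
  (measurable_ordstat_pdf _ _ _ _ _)
  (fun x => ordstat_pdf_ge0 _ _ _ _ _ x s10) hX1
  (measurable_ordstat_pdf _ _ _ _ _)
  (fun x => ordstat_pdf_ge0 _ _ _ _ _ x s20) hX2
  (measurable_gamma_pdf _ _ _) (fun x => gamma_pdf_ge0 _ _ _ x s10) hV1
  (measurable_gamma_pdf _ _ _) (fun x => gamma_pdf_ge0 _ _ _ x s20) hV2.
pose G (s : RR * (RR * (RR * RR))) : \bar R :=
  (pos_loss L (phi (s.2.1 / s.1, (s.2.2.1 / s.1, s.2.2.2 / s.1)) * s.1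
    / sigma1 th))%:E.
have mG : measurable_fun setT G.
  apply/measurable_EFinP; apply: (measurableT_comp (measurable_pos_loss hL)).
  have mV : measurable_fun setT (fun s : RR * (RR * (RR * RR)) => s.1^-1 : R).
    by apply: (measurableT_comp (measurable_invr _)).
  apply: measurable_funM => //; apply: measurable_funM => //.
  apply: (measurableT_comp mphi); apply: measurable_fun_pair.
    exact: (measurable_funM m2 mV).
  apply: measurable_fun_pair; first exact: (measurable_funM m3 mV).
  exact: (measurable_funM m4 mV).
have G0 s : (0 <= G s)%E by rewrite lee_fin pos_loss_ge0.
(* The formula for [delta] is only available where [V_1 > 0]; the complement is a null event. *)
transitivity (\int[P th]_w G (V1 w, (V2 w, (X1 w, X2 w))))%E.
  rewrite risk_pos_loss//; last by move=> w V10; rewrite deltaE// mulr_gt0.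
  apply: ge0_ae_eq_integral => //.
  - apply/measurable_EFinP; apply: (measurableT_comp (measurable_pos_loss hL)).
    exact: measurable_funM.
  - apply: (measurableT_comp mG); do 3?apply: measurable_fun_pair => //.
    + exact: (measurable_funP V1).
    + exact: (measurable_funP V2).
    + exact: (measurable_funP X1).
    + exact: (measurable_funP X2).
  - by move=> w _; rewrite lee_fin pos_loss_ge0.
  exists (V1 @^-1` `]-oo, 0]); split.
  - by rewrite -[X in measurable X]setTI; exact: measurable_funP.
  - exact: censored_V1_gt0.
  move=> w /= /not_implyP[_ h]; rewrite in_itv/= leNgt; apply/negP => V10.
  by apply: h; rewrite /G /= -deltaE.
rewrite law// /leb4.
have mGd : measurable_fun setT (fun s => G s * (dens s)%:E)%E.
  by apply: emeasurable_funM => //; exact/measurable_EFinP.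
have Gd0 s : (0 <= G s * (dens s)%:E)%E by rewrite mule_ge0// lee_fin.
rewrite ge0_integral_sigma_finite_prod//.
transitivity (\int[leb]_v \int[leb3]_z ratio_integrand (v, z))%E; last first.
  by apply: fubini_tonelli;
    [exact: measurable_ratio_integrand|exact: ratio_integrand_ge0].
apply: eq_integral => v _.
(* Scaling by [v] requires [v > 0]; for the other [v] the density of [V_1] makes both sides
   vanish. *)
have [v0|v0] := leP (v : R) 0.
  rewrite !integral0_eq// => z _; last first.
    by rewrite /dens {1}/gamma_pdf ltNge v0/= mul0r mule0.
  rewrite /ratio_integrand /ratio_kernel {1}/gamma_pdf.
  by rewrite ltNge v0/= mul0r mulr0 mule0.
have mGdv : measurable_fun setT (fun y => G (v, y) * (dens (v, y))%:E)%E.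
  exact: (measurable_fun_pair2 v mGd).
rewrite (ge0_integral_leb3_scale _ v _ v0 mGdv)//.
rewrite -ge0_integralZl//; last 2 first.
  apply: (measurableT_comp mGdv); apply: measurable_fun_pair.
    by apply: measurable_funM => //; exact: measurable_fst.
  apply: measurable_fun_pair.
    by apply: measurable_funM => //; apply: (measurableT_comp measurable_fst).
  by apply: measurable_funM => //; apply: (measurableT_comp measurable_snd).
  by rewrite lee_fin exprn_ge0// ltW.
apply: eq_integral => -[z1 [z2 z3]] _.
rewrite muleA [((v ^+ 3)%:E * _)%E]muleC -muleA -EFinM.
rewrite /G /ratio_integrand /= -EFinM; congr (_ * _)%:E.
by rewrite ![v * _ / v]mulrAC divff ?gt_eqF// !mul1r.
Qed.

End risk_formula.

(** * Bowl-shaped losses and gamma means *)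

Section bowl_shaped_loss.
Context {R : realType} {L : R -> R}.
Hypothesis hL : bowl_shaped L.

(** For [|h| < min t (1 - t)] the point [t + h] stays in []0, 1[], where [L] is nonincreasing, so
    every such difference quotient is nonpositive. *)
Lemma bowl_shaped_derive_le0 (t : R) : 0 < t -> t < 1 -> (L^`())%classic t <= 0.
Proof.
have [_ dL _ Ld _] := hL => t0 t1.
apply: limr_le.
  under eq_fun; first (move=> h; rewrite -{2}(scaler1 h); over).
  exact: dL.
near=> h.
have h0 : h != 0 by near: h; exact: nbhs_dnbhs_neq.
have : `|h| < Num.min t (1 - t).
  by near: h; apply: dnbhs0_lt; rewrite lt_min t0 subr_gt0.
rewrite lt_min => /andP[]; rewrite !ltr_norml => /andP[ht _] /andP[_ ht1].
move: h0; rewrite neq_lt => /orP[h0|h0].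
- by rewrite nmulr_rle0 ?invr_lt0// subr_ge0; apply: Ld; lra.
- by rewrite pmulr_rle0 ?invr_gt0// subr_le0; apply: Ld; lra.
Unshelve. end_near. Qed.

Lemma bowl_shaped_derive_ge0 (t : R) : 1 < t -> 0 <= (L^`())%classic t.
Proof.
have [_ dL _ _ Li] := hL => t1.
apply: limr_ge.
  under eq_fun; first (move=> h; rewrite -{2}(scaler1 h); over).
  by apply: dL; rewrite (lt_trans _ t1).
near=> h.
have h0 : h != 0 by near: h; exact: nbhs_dnbhs_neq.
have : `|h| < t - 1.
  by near: h; apply: dnbhs0_lt; rewrite subr_gt0.
rewrite ltr_norml => /andP[ht _].
move: h0; rewrite neq_lt => /orP[h0|h0].
- by rewrite nmulr_rge0 ?invr_lt0// subr_le0; apply: Li; lra.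
- by rewrite pmulr_rge0 ?invr_gt0// subr_ge0; apply: Li; lra.
Unshelve. end_near. Qed.

(** Below [e^-1] both arguments are at most 1, above [e'^-1] both are at least 1, and monotonicity
    decides. In between, [L (e * v)] is nondecreasing and [L (e' * v)] nonincreasing in [v], so
    their difference changes sign at most once; [u0] is the supremum of the points of this interval
    where it is still nonpositive. *)
Lemma bowl_shaped_crossing (e' e : R) : 0 < e' -> e' < e ->
  exists2 u0, 0 < u0 &
    (forall v, 0 < v -> v < u0 -> L (e * v) <= L (e' * v)) /\
    (forall v, u0 < v -> L (e' * v) <= L (e * v)).
Proof.
have [_ _ L1 Ld Li] := hL => e'0 e'e.
have e0 : 0 < e by exact: lt_trans e'e.
pose E := [set u | [/\ e^-1 <= u, u <= e'^-1 & L (e * u) <= L (e' * u)]].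
have ie : e^-1 < e'^-1 by rewrite ltf_pV2.
have L0 t : 0 < t -> 0 <= L t.
  by move=> t0; have := pos_loss_ge0 hL t; rewrite /pos_loss t0.
have Ee : E e^-1.
  split => //; first exact: ltW.
  by rewrite divff ?gt_eqF// L1 L0// divr_gt0.
have supE : has_sup E.
  by split; [exists e^-1|exists e'^-1 => u []].
have le_u0 : e^-1 <= sup E by exact: sup_upper_bound.
exists (sup E); first by rewrite (lt_le_trans _ le_u0)// invr_gt0.
have ltM (a b : R) : 0 < a -> a^-1 <= b -> 1 <= a * b.
  by move=> a0 ab; rewrite -ler_pdivrMl// mulr1.
have leM (a b : R) : 0 < a -> b <= a^-1 -> a * b <= 1.
  by move=> a0 ab; rewrite -ler_pdivlMl// mulr1.
split=> v.
  move=> v0 /sup_gt[|u [eu ue' Lu] vu]; first by exists e^-1.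
  have [ve|/ltW ev] := leP v e^-1.
    apply: Ld; [exact: mulr_gt0|by rewrite ler_pM2r// ltW|exact: leM].
  apply: (@le_trans _ _ (L (e * u))).
    by apply: Li; [exact: ltM|rewrite ler_pM2l// ltW].
  apply: (le_trans Lu); apply: Ld; [exact: mulr_gt0| |exact: leM].
  by rewrite ler_pM2l// ltW.
move=> vu; have [e'v|ve'] := leP e'^-1 v.
  apply: Li; first exact: ltM.
  by rewrite ler_pM2r ?ltW// (lt_le_trans _ e'v)// invr_gt0.
rewrite leNgt; apply/negP => /ltW Lv.
have : v <= sup E.
  apply: sup_upper_bound => //; split => //; last exact: ltW.
  exact: ltW (le_lt_trans le_u0 vu).
by rewrite leNgt vu.
Qed.

End bowl_shaped_loss.

Lemma integrable_leb_scale {R : realType} (v : R)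
    (F : measurableTypeR R -> \bar R) :
  0 < v -> leb.-integrable setT F ->
  leb.-integrable setT (fun x => F (v * x)%R).
Proof.
move=> v0 /integrableP[mF Foo]; apply/integrableP; split.
  by apply: (measurableT_comp mF); exact: mulrl_measurable.
rewrite (ge0_integral_leb_scale _ v (fun x => `|F x|%E)) in Foo => //;
  last first.
  exact: measurableT_comp.
rewrite ltNge leye_eq; apply/eqP => h; move: Foo.
by rewrite h gt0_muley ?lte_fin// ltxx.
Qed.

Lemma integral_leb_scale {R : realType} (v : R)
    (F : measurableTypeR R -> \bar R) :
  0 < v -> leb.-integrable setT F ->
  (\int[leb]_x F x = v%:E * \int[leb]_x F (v * x)%R)%E.
Proof.
move=> v0 iF.
have iFv := integrable_leb_scale v F v0 iF.
have mF : measurable_fun setT F by case/integrableP : iF.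
rewrite integralE (ge0_integral_leb_scale _ v (funepos F))//; last first.
  exact: measurable_funepos.
rewrite (ge0_integral_leb_scale _ v (funeneg F))//; last first.
  exact: measurable_funeneg.
have -> : (\int[leb]_x F^\+ (v * x)%R =
    \int[leb]_x (fun x => F (v * x)%R)^\+ x)%E.
  by apply: eq_integral => x _; rewrite !funeposE.
have -> : (\int[leb]_x F^\- (v * x)%R =
    \int[leb]_x (fun x => F (v * x)%R)^\- x)%E.
  by apply: eq_integral => x _; rewrite !funenegE.
rewrite [in RHS]integralE; apply/esym; apply: muleBr => //.
exact: integrable_add_def.
Qed.

Lemma gamma_meanE {R : realType} (k : nat) (f : R -> R) :
  gamma_mean k f = fine (\int[leb]_x (f x * gamma_pdf k 1 x)%:E)%E.
Proof.
rewrite /gamma_mean /Rintegral integral_mkcond; congr fine.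
apply: eq_integral => x _; rewrite patchE; case: ifPn => //.
rewrite notin_setE/= in_itv/= andbT => /negP x0.
by rewrite /gamma_pdf (negbTE x0) mulr0.
Qed.

Lemma gamma_integrableT {R : realType} (k : nat) (f : R -> R) :
  gamma_integrable k f ->
  leb.-integrable setT (fun x => (f x * gamma_pdf k 1 x)%:E).
Proof.
rewrite /gamma_integrable => /(integrable_mkcond _ _).1 h.
apply: eq_integrable (h _) => // x _.
rewrite patchE; case: ifPn => //.
rewrite notin_setE/= in_itv/= andbT => /negP x0.
by rewrite /gamma_pdf (negbTE x0) mulr0.
Qed.

(** This is the likelihood ratio of two gamma laws of equal shape, up to a constant: an exponential
    in [x], nondecreasing when [r <= 1]. *)
Lemma gamma_pdf_scale {R : realType} (k : nat) (r x : R) : 0 < r ->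
  gamma_pdf k 1 (r * x) = r ^+ (k - 1) * expR ((1 - r) * x) * gamma_pdf k 1 x.
Proof.
move=> r0; rewrite /gamma_pdf pmulr_rgt0//.
case: ifPn => _; last by rewrite mulr0.
have -> : expR (- (r * x / 1)) = expR ((1 - r) * x) * expR (- (x / 1)).
  by rewrite -expRD; congr expR; rewrite !divr1; ring.
by rewrite exprMn -!mulrA; congr (_ * _); rewrite mulrCA.
Qed.

Lemma gamma_pdfS {R : realType} (k : nat) (x : R) : (0 < k)%N ->
  gamma_pdf k.+1 1 x = x * gamma_pdf k 1 x / k%:R.
Proof.
case: k => // k _; rewrite /gamma_pdf !subSS !subn0.
case: ifPn => _; last first.
  by rewrite mulr0 mul0r.
rewrite !expr1n !mulr1 factS natrM exprS; field.
by rewrite nat1r !pnatr_eq0 -!lt0n fact_gt0.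
Qed.

Section gamma_loss.
Context {R : realType} {L : R -> R} {k : nat}.
Hypotheses (hL : bowl_shaped L) (k0 : (0 < k)%N) (hreg : regular_loss k L).

Let M (c : R) : R := gamma_mean k (fun x => (L^`())%classic (c * x) * x).

(** The factor [x] produced by differentiation raises the shape by one, so the positive roots of the
    equation that defines [beta2] are exactly the positive zeros of the derivative [M] of the risk
    at shape [k]. *)
Lemma gamma_mean_deriveS (c : R) : 0 < c ->
  gamma_mean k.+1 (fun u => (L^`())%classic (u * c)) = M c / k%:R.
Proof.
move=> c0; rewrite /M !gamma_meanE.
have [_ /gamma_integrableT i _] := hreg c c0.
transitivity (fine (\int[leb]_x
    (((L^`())%classic (c * x) * x * gamma_pdf k 1 x)%:E * (k%:R^-1)%:E))%E).
  congr fine; apply: eq_integral => x _; rewrite gamma_pdfS// -EFinM.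
  by rewrite !mulrA [x * c]mulrC.
by rewrite integralZr// fineM// integrable_fin_num.
Qed.

(* The factor [expR ((1 - r) * x)], [r = c / c'], is larger where [L' (c * x)]
   is nonnegative, [x >= 1 / c], than where it is nonpositive. *)
Lemma gamma_mean_derive_ge0 (c c' : R) :
  0 < c -> c < c' -> M c = 0 -> 0 <= M c'.
Proof.
move=> c0 cc' Mc0.
have c'0 : 0 < c' by exact: lt_trans cc'.
have [_ /gamma_integrableT i _] := hreg c c0.
have [_ /gamma_integrableT i' _] := hreg c' c'0.
pose r := c / c'.
have r0 : 0 < r by rewrite divr_gt0.
have r1 : 0 < 1 - r by rewrite subr_gt0 ltr_pdivrMr// mul1r.
rewrite /M gamma_meanE (integral_leb_scale r)//.
rewrite fineM//; last first.
  by apply: integrable_fin_num => //; exact: (integrable_leb_scale r _ r0 i').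
rewrite mulr_ge0 ?(ltW r0)//=.
(* After the substitution [x |-> r * x] the two integrands differ by the factor
   [r ^+ (k - 1) * r * expR ((1 - r) * x)]; [w] is its value at [x = 1 / c], where [L'] changes
   sign. As [M c = 0], the multiple by [w] of that integral is 0. *)
set w := r ^+ (k - 1) * r * expR ((1 - r) / c).
have -> : 0 = fine (w%:E * \int[leb]_x
    ((L^`())%classic (c * x) * x * gamma_pdf k 1 x)%:E)%E.
  rewrite fineM ?integrable_fin_num//= -[X in w * X]gamma_meanE.
  by rewrite -/(M c) Mc0 mulr0.
rewrite -integralZl//.
apply: fine_le.
- by apply: integrable_fin_num => //; exact: integrableZl.
- by apply: integrable_fin_num => //; exact: (integrable_leb_scale r _ r0 i').
apply: le_integral => //; [exact: integrableZl|
  exact: (integrable_leb_scale r _ r0 i')|].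
move=> x _; rewrite -EFinM lee_fin gamma_pdf_scale//.
have [x0|x0] := leP (x : R) 0.
  by rewrite /gamma_pdf [(0 < x)%R]ltNge x0/= !mulr0.
have -> : c' * (r * x) = c * x by rewrite /r mulrA mulrCA divff ?gt_eqF// mulr1.
have -> : (L^`())%classic (c * x) * (r * x) *
    (r ^+ (k - 1) * expR ((1 - r) * x) * gamma_pdf k 1 x) =
  (r ^+ (k - 1) * r * x * gamma_pdf k 1 x) *
    ((L^`())%classic (c * x) * expR ((1 - r) * x)).
  by ring.
have -> : w * ((L^`())%classic (c * x) * x * gamma_pdf k 1 x) =
  (r ^+ (k - 1) * r * x * gamma_pdf k 1 x) *
    ((L^`())%classic (c * x) * expR ((1 - r) / c)).
  by rewrite /w; ring.
apply: ler_wpM2l.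
  have x0' := ltW x0; have r0' := ltW r0.
  by do 3?apply: mulr_ge0 => //; [exact: exprn_ge0|exact: gamma_pdf_ge0].
have [x1|x1|x1] := ltgtP (c * x) 1.
- apply: ler_wnM2l.
    by apply: bowl_shaped_derive_le0 => //; rewrite mulr_gt0.
  by rewrite ler_expR ler_pM2l// -[_^-1]mulr1 ler_pdivlMl// ltW.
- apply: ler_wpM2l; first exact: bowl_shaped_derive_ge0.
  by rewrite ler_expR ler_pM2l// -[_^-1]mulr1 ler_pdivrMl// ltW.
- have -> : x = c^-1.
    by apply: (mulfI (lt0r_neq0 c0)); rewrite x1 divff// gt_eqF.
  by [].
Qed.

(** By the mean value theorem the increment is [M x * (e - c)] with [x] in []c, e[]; there [M x] is
    nonnegative by the likelihood ratio argument and nonzero because [c] is the only root. *)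
Lemma gamma_mean_loss_lt (c e : R) :
  unique_pos_root
    (fun c => gamma_mean k.+1 (fun u => (L^`())%classic (u * c))) c ->
  c < e ->
  gamma_mean k (fun x => L (c * x)) < gamma_mean k (fun x => L (e * x)).
Proof.
move=> [c0 hc huniq] ce.
have k0R : (k%:R : R) != 0 by rewrite pnatr_eq0 -lt0n.
have Mc : M c = 0.
  move: hc; rewrite gamma_mean_deriveS// => /eqP.
  by rewrite mulf_eq0 invr_eq0 (negbTE k0R) orbF => /eqP.
pose Q (e : R) := gamma_mean k (fun x => L (e * x)).
have dQ (x : R) : 0 < x -> is_derive x (1 : R) Q (M x).
  by move=> x0; have [] := hreg x x0.
have [x||x] := @MVT _ Q M c e ce.
- by rewrite in_itv/= => /andP[cx _]; apply: dQ; exact: lt_trans cx.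
- apply: derivable_within_continuous => x; rewrite in_itv/= => /andP[cx _].
  by have [] := dQ x (lt_le_trans c0 cx).
rewrite in_itv/= => /andP[cx xe] QE.
rewrite -subr_gt0 -/(Q c) -/(Q e) QE mulr_gt0 ?subr_gt0//.
have x0 : 0 < x by exact: lt_trans cx.
rewrite lt_neqAle (gamma_mean_derive_ge0 c) ?andbT//.
apply/eqP => Mx0; have := huniq x x0.
rewrite gamma_mean_deriveS// -Mx0 mul0r => /(_ erefl) xc.
by rewrite xc ltxx in cx.
Qed.

End gamma_loss.

(** If the integrals were equal, [g - f] would vanish almost everywhere, against the strict
    inequality on [B]. Strictness is asked only where [g] is finite, which is almost everywhere
    since its integral is finite. *)
Lemma ge0_lt_integral d (T : measurableType d) (R : realType)
    (mu : {measure set T -> \bar R}) (f g : T -> \bar R) (B : set T) :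
  measurable_fun setT f -> measurable_fun setT g ->
  (forall x, 0 <= f x)%E -> (forall x, f x <= g x)%E ->
  (\int[mu]_x g x < +oo)%E ->
  measurable B -> (0 < mu B)%E ->
  (forall x, B x -> g x < +oo -> f x < g x)%E ->
  (\int[mu]_x f x < \int[mu]_x g x)%E.
Proof.
move=> mf mg f0 fg goo mB B0 fgB.
have g0 x : (0 <= g x)%E := le_trans (f0 x) (fg x).
have le_fg : (\int[mu]_x f x <= \int[mu]_x g x)%E by exact: ge0_le_integral.
rewrite lt_neqAle le_fg andbT; apply/eqP => fgE.
have ffin : (\int[mu]_x f x)%E \is a fin_num.
  by rewrite ge0_fin_numE ?fgE//; exact: integral_ge0.
(* The positive part makes [g = f + u] hold even where both are infinite: there [+oo - +oo] is
   [-oo], and [u] is 0. *)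
pose u := (fun x => g x - f x)^\+%E.
have mu_ : measurable_fun setT u.
  by apply: measurable_funepos; exact: emeasurable_funB.
have u0 x : (0 <= u x)%E by exact: funepos_ge0.
have guE x : (g x = f x + u x)%E.
  rewrite /u funeposE; move: (f0 x) (fg x).
  case: (f x) => [a| |]//; case: (g x) => [b| |]//.
  - rewrite lee_fin -EFinB => _ ab; rewrite max_l ?lee_fin ?subr_ge0//.
    by rewrite -EFinD subrKC.
  - by move=> _ _ /=; rewrite max_r ?adde0// leNye.
have ui0 : (\int[mu]_x u x = 0)%E.
  have gE : (\int[mu]_x g x = \int[mu]_x f x + \int[mu]_x u x)%E.
    by rewrite -ge0_integralD//; apply: eq_integral => x _; exact: guE.
  move: gE; rewrite -fgE; have := integral_ge0 mu (fun x (_ : setT x) => u0 x).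
  move: ffin; case: (\int[mu]_x f x)%E => // r _.
  case: (\int[mu]_x u x)%E => //= s _ [] /eqP.
  by rewrite -[X in X == _]addr0 (inj_eq (addrI r)) => /eqP <-.
have ig : mu.-integrable setT g.
  apply/integrableP; split => //.
  by under eq_integral do rewrite gee0_abs//.
have [N1 [mN1 N10 sN1]] := integrable_ae measurableT ig.
have : (\int[mu]_x `|u x| = 0)%E by under eq_integral do rewrite gee0_abs//.
move=> /(ae_eq_integral_abs _ _ _).1 => /(_ measurableT mu_)[N2 [mN2 N20 sN2]].
suff : mu B = 0%E by move=> B00; rewrite B00 ltxx in B0.
have N0 : mu (N1 `|` N2) = 0%E.
  apply/eqP; rewrite -measure_le0 (le_trans (measureU2 _ _ _))//.
  by rewrite [X in (X + _)%E]N10 [X in (_ + X)%E]N20 adde0.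
apply/eqP; rewrite -measure_le0 -N0.
apply: le_measure; rewrite ?inE//; first exact: measurableU.
move=> x Bx; apply: contrapT => /not_orP[N1x N2x].
have gx : g x \is a fin_num.
  by apply: contrapT => h; apply: N1x; apply: sN1 => /(_ Logic.I).
have ux : u x = 0%E.
  by apply: contrapT => h; apply: N2x; apply: sN2 => /(_ Logic.I).
have := fgB x Bx; rewrite -ge0_fin_numE// => /(_ gx).
by rewrite guE ux adde0 ltxx.
Qed.

(** * Comparison of risks under a nondecreasing weight *)

Section weighted_comparison.
Context {R : realType} {L : R -> R} {k : nat}.
Hypothesis hL : bowl_shaped L.
Variables (e' e l : R) (K H : R -> R).
Hypotheses (e'0 : 0 < e') (ee' : e' < e) (l0 : 0 < l).
Hypothesis ie' : gamma_integrable k (fun x => L (e' * x)).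
Hypothesis ie : gamma_integrable k (fun x => L (e * x)).
Hypothesis Qlt :
  gamma_mean k (fun x => L (e' * x)) < gamma_mean k (fun x => L (e * x)).
Hypothesis mK : measurable_fun setT (K : measurableTypeR R -> R).
Hypothesis KE : forall v, K v = H v * gamma_pdf k 1 (l * v).
Hypothesis H0 : forall v : R, 0 < v -> 0 <= H v.
Hypothesis Hhomo : forall v w : R, 0 < v -> v <= w -> H v <= H w.

Local Notation I c :=
  (\int[leb]_v ((pos_loss L (c * (l * v)))%:E * (K v)%:E))%E.

Let A (c : R) : \bar R :=
  (\int[leb]_v (pos_loss L (c * (l * v)) * gamma_pdf k 1 (l * v))%:E)%E.

Let AE (c : R) : 0 < c -> gamma_integrable k (fun x => L (c * x)) ->
  A c = (l^-1 * gamma_mean k (fun x => L (c * x)))%:E.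
Proof.
move=> c0 /gamma_integrableT i.
have mF : measurable_fun setT
    (fun x : measurableTypeR R => (pos_loss L (c * x) * gamma_pdf k 1 x)%:E).
  apply/measurable_EFinP; apply: measurable_funM;
    last exact: measurable_gamma_pdf.
  apply: (measurableT_comp (measurable_pos_loss hL)); exact: mulrl_measurable.
have F0 (x : measurableTypeR R) :
    (0 <= (pos_loss L (c * x) * gamma_pdf k 1 x)%:E)%E.
  by rewrite lee_fin mulr_ge0 ?pos_loss_ge0 ?gamma_pdf_ge0.
have : (\int[leb]_x (pos_loss L (c * x) * gamma_pdf k 1 x)%:E = l%:E * A c)%E.
  exact: (ge0_integral_leb_scale _ l _ l0 mF F0).
have -> : (\int[leb]_x (pos_loss L (c * x) * gamma_pdf k 1 x)%:E =
    \int[leb]_x (L (c * x) * gamma_pdf k 1 x)%:E)%E.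
  apply: eq_integral => x _; have [x0|x0] := leP (x : R) 0.
    by rewrite /gamma_pdf [(0 < x)%R]ltNge x0/= !mulr0.
  by rewrite /pos_loss pmulr_rgt0// x0.
rewrite EFinM gamma_meanE fineK; last exact: (integrable_fin_num measurableT i).
move=> ->.
by rewrite muleA -EFinM mulVf ?gt_eqF// mul1e.
Qed.

(** This is [(p - p') * (H v - H u) * g >= 0] rearranged: both differences pass from nonpositive to
    nonnegative at the crossing point [u]. The terms are distributed so that each is nonnegative,
    and the inequality can be integrated without subtracting possibly infinite integrals. *)
Let crossing : exists2 u, 0 < u & forall v,
  pos_loss L (e' * (l * v)) * K v +
    H u * (pos_loss L (e * (l * v)) * gamma_pdf k 1 (l * v)) <=
  pos_loss L (e * (l * v)) * K v +
    H u * (pos_loss L (e' * (l * v)) * gamma_pdf k 1 (l * v)).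
Proof.
have [t t0 [tl tr]] := bowl_shaped_crossing hL e' e e'0 ee'.
have e0 : 0 < e by exact: lt_trans ee'.
exists (t / l); first by rewrite divr_gt0.
move=> v; rewrite KE.
set g := gamma_pdf k 1 (l * v).
set p := pos_loss L (e * (l * v)); set p' := pos_loss L (e' * (l * v)).
have [v0|v0] := leP v 0.
  suff -> : g = 0 by rewrite !mulr0.
  by rewrite /g /gamma_pdf pmulr_rgt0// ltNge v0.
have lv0 : 0 < l * v by exact: mulr_gt0.
have g0 : 0 <= g by exact: gamma_pdf_ge0.
rewrite -subr_ge0.
have -> : p * (H v * g) + H (t / l) * (p' * g) -
    (p' * (H v * g) + H (t / l) * (p * g))
  = (p - p') * (H v - H (t / l)) * g by ring.
apply: mulr_ge0 => //.
have pE : p = L (e * (l * v)) by rewrite /p /pos_loss ifT// mulr_gt0.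
have p'E : p' = L (e' * (l * v)) by rewrite /p' /pos_loss ifT// mulr_gt0.
have [vt|vt|->] := ltgtP v (t / l); last by rewrite subrr mulr0.
- apply: mulr_le0; rewrite subr_le0.
    by rewrite pE p'E; apply: tl => //; rewrite mulrC -ltr_pdivlMr.
  by apply: Hhomo => //; exact: ltW.
- apply: mulr_ge0; rewrite subr_ge0.
    by rewrite pE p'E; apply: tr; rewrite mulrC -ltr_pdivrMr.
  by apply: Hhomo; [rewrite divr_gt0|exact: ltW].
Qed.

Let K0 v : 0 <= K v.
Proof.
rewrite KE; have [v0|v0] := leP v 0.
  by rewrite /gamma_pdf pmulr_rgt0// ltNge v0/= mulr0.
by rewrite mulr_ge0 ?H0 ?gamma_pdf_ge0.
Qed.

Let weighted_key : exists2 u, 0 < u &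
  (I e' + (H u * (l^-1 * gamma_mean k (fun x => L (e * x))))%:E <=
   I e + (H u * (l^-1 * gamma_mean k (fun x => L (e' * x))))%:E)%E.
Proof.
have [u u0 hu] := crossing; exists u => //.
have e0 : 0 < e by exact: lt_trans ee'.
rewrite !(EFinM (H u) (l^-1 * _)) -!AE//.
have mp c : measurable_fun setT
    (fun v : measurableTypeR R => pos_loss L (c * (l * v))).
  apply: (measurableT_comp (measurable_pos_loss hL)).
  by apply: measurable_funM => //; exact: mulrl_measurable.
have mpK c : measurable_fun setT
    (fun v : measurableTypeR R => (pos_loss L (c * (l * v)))%:E * (K v)%:E)%E.
  by apply: emeasurable_funM; exact/measurable_EFinP.
have mpg c : measurable_fun setT
    (fun v : measurableTypeR R =>
      (pos_loss L (c * (l * v)) * gamma_pdf k 1 (l * v))%:E).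
  apply/measurable_EFinP; apply: measurable_funM => //.
  apply: (measurableT_comp (measurable_gamma_pdf _ _ _)).
  exact: mulrl_measurable.
have pK0 c v : (0 <= (pos_loss L (c * (l * v)))%:E * (K v)%:E)%E.
  by rewrite mule_ge0// lee_fin ?K0 ?pos_loss_ge0.
have pg0 c v : (0 <= (pos_loss L (c * (l * v)) * gamma_pdf k 1 (l * v))%:E)%E.
  by rewrite lee_fin mulr_ge0 ?pos_loss_ge0 ?gamma_pdf_ge0.
have Hu0 : (0 <= (H u)%:E)%E by rewrite lee_fin H0.
rewrite -!ge0_integralZl//.
rewrite -!ge0_integralD//; [|by move=> ? _; rewrite mule_ge0
  |exact: measurable_funeM|by move=> ? _; rewrite mule_ge0
  |exact: measurable_funeM].
apply: ge0_le_integral => //.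
- by move=> v _; rewrite adde_ge0// mule_ge0.
- by apply: emeasurable_funD => //; exact: measurable_funeM.
- by apply: emeasurable_funD => //; exact: measurable_funeM.
- by move=> v _; rewrite -!EFinM -!EFinD lee_fin.
Qed.

(** By [weighted_key] the gain [I e - I e'] is at least [H u / l] times the gain in the unweighted
    gamma mean; if [I e'] is infinite, then so is [I e]. *)
Lemma weighted_loss_le : (I e' <= I e)%E.
Proof.
have [u u0] := weighted_key.
have I0 c : (0 <= I c)%E.
  by apply: integral_ge0 => v _; rewrite mule_ge0// lee_fin ?K0 ?pos_loss_ge0.
have := H0 u u0; have l0' : 0 < l^-1 by rewrite invr_gt0.
move: Qlt (I0 e') (I0 e); set q' := gamma_mean _ _; set q := gamma_mean _ _.
case: (I e') => [i'| |]; case: (I e) => [i| |]//= qq _ _ Hu0; rewrite ?leey//.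
rewrite -!EFinD !lee_fin => h.
have : 0 <= H u * (l^-1 * (q - q')) by rewrite !mulr_ge0// ?ltW// subr_gt0.
by move=> h'; nra.
Qed.

Lemma weighted_loss_lt : (forall v : R, 0 < v -> 0 < H v) -> (I e < +oo)%E ->
  (I e' < I e)%E.
Proof.
move=> Hgt0; have [u u0] := weighted_key.
have I0 c : (0 <= I c)%E.
  by apply: integral_ge0 => v _; rewrite mule_ge0// lee_fin ?K0 ?pos_loss_ge0.
have := Hgt0 u u0; have l0' : 0 < l^-1 by rewrite invr_gt0.
move: Qlt (I0 e') (I0 e); set q' := gamma_mean _ _; set q := gamma_mean _ _.
case: (I e') => [i'| |]; case: (I e) => [i| |]//= qq _ _ Hu0.
rewrite -!EFinD !lee_fin lte_fin => h _.
have : 0 < H u * (l^-1 * (q - q')) by rewrite !mulr_gt0// subr_gt0.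
by move=> h'; nra.
Qed.

End weighted_comparison.

(** * The conditional density of the scale statistic *)

(* The exponential factor undoes a decay of the density at rate [1 / s], which
   is at least as fast as its actual rate [1 / sigma]. *)
Lemma ordstat_pdf_tilt_homo (R : realType) (n a : nat) (mu sigma s z v w : R) :
  0 < s -> s <= sigma -> 0 < z -> v <= w ->
  ordstat_pdf n a mu sigma (v * z) * expR ((n - a + 1)%:R * (v * z / s)) <=
  ordstat_pdf n a mu sigma (w * z) * expR ((n - a + 1)%:R * (w * z / s)).
Proof.
move=> s0 ss z0 vw; have sg0 : 0 < sigma by exact: lt_le_trans ss.
have vwz : v * z <= w * z by rewrite ler_pM2r.
rewrite {1}/ordstat_pdf; case: ifPn => [muv|_]; last first.
  by rewrite mul0r mulr_ge0 ?expR_ge0 ?ordstat_pdf_ge0.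
rewrite /ordstat_pdf ifT; last exact: lt_le_trans vwz.
move: (v * z) (w * z) vwz muv => {vw}v {}w vw muv.
rewrite -!expRM_natl -!(mulrA _ (expR _) (expR _)) -!expRD.
apply: ler_pM; rewrite ?expR_ge0//.
- rewrite !mulr_ge0 ?invr_ge0 ?mulr_ge0 ?ler0n ?(ltW sg0)// exprn_ge0//.
  by rewrite subr_ge0 expR_le1 oppr_le0 divr_ge0 ?subr_ge0 ?ltW.
- rewrite ler_pM2r ?invr_gt0//; apply: ler_wpM2l.
    by rewrite mulr_ge0 ?invr_ge0 ?mulr_ge0 ?ler0n.
  apply: lerXn2r; rewrite ?nnegrE.
  + by rewrite subr_ge0 expR_le1 oppr_le0 divr_ge0 ?subr_ge0 ?ltW.
  + rewrite subr_ge0 expR_le1 oppr_le0 divr_ge0 ?(ltW sg0)// subr_ge0 ltW//.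
    exact: lt_le_trans vw.
  + by rewrite lerD2l lerN2 ler_expR lerN2 ler_pM2r ?invr_gt0// lerD2r.
- rewrite ler_expR -!mulrDr ler_wpM2l ?ler0n//.
  have -> : - ((v - mu) / sigma) + v / s = mu / sigma + v * (s^-1 - sigma^-1).
    by field; rewrite !gt_eqF.
  have -> : - ((w - mu) / sigma) + w / s = mu / sigma + w * (s^-1 - sigma^-1).
    by field; rewrite !gt_eqF.
  by rewrite lerD2l ler_wpM2r// subr_ge0 lef_pV2.
Qed.

Lemma ordstat_pdf_gt0 (R : realType) (n a : nat) (mu sigma x : R) :
  0 < sigma -> mu < x -> 0 < ordstat_pdf n a mu sigma x.
Proof.
move=> s0 mux; rewrite /ordstat_pdf mux.
rewrite !mulr_gt0 ?invr_gt0 ?mulr_gt0 ?exprn_gt0 ?expR_gt0 ?ltr0n ?fact_gt0//.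
by rewrite subr_gt0 expR_lt1 oppr_lt0 divr_gt0 ?subr_gt0.
Qed.

Definition ratio_rate {R : realType} (n1 a1 n2 a2 : nat)
    (z : R * (R * R)) : R :=
  1 + z.1 + (n1 - a1 + 1)%:R * z.2.1 + (n2 - a2 + 1)%:R * z.2.2.

Lemma ratio_rate_gt0 {R : realType} (n1 a1 n2 a2 : nat) (z : R * (R * R)) :
  0 < z.1 -> 0 < z.2.1 -> 0 < z.2.2 -> 0 < ratio_rate n1 a1 n2 a2 z.
Proof.
move=> z1 z2 z3; rewrite /ratio_rate.
have := mulr_ge0 (ler0n R (n1 - a1 + 1)) (ltW z2).
have := mulr_ge0 (ler0n R (n2 - a2 + 1)) (ltW z3).
lra.
Qed.

(** Every exponential decay is replaced by decay at rate [1 / sigma1], which adds up to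
    [ratio_rate / sigma1]. What is left over makes up [H]: the factor [e0], nondecreasing because
    [sigma1 <= sigma2], and the two tilted order statistic densities. For nonpositive locations
    every [v * z_i] lies inside the supports, so [H] is positive. *)
Lemma ratio_kernel_weight {R : realType} (n1 a1 b1 n2 a2 b2 : nat)
    (th : param R) (z : R * (R * R)) :
  (a1 < b1)%N -> (a2 < b2)%N -> admissible th ->
  0 < z.1 -> 0 < z.2.1 -> 0 < z.2.2 ->
  exists H : R -> R,
  [/\ forall v, ratio_kernel n1 a1 b1 n2 a2 b2 th z v =
        H v * gamma_pdf (b1 + b2 - (a1 + a2) + 2) 1
          (ratio_rate n1 a1 n2 a2 z / sigma1 th * v),
      forall v, 0 < v -> 0 <= H v,
      forall v w, 0 < v -> v <= w -> H v <= H w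
    & mu1 th <= 0 -> mu2 th <= 0 -> forall v, 0 < v -> 0 < H v].
Proof.
move=> ab1 ab2.
(* Total power of [v]: 3 from the Jacobian and [b_i - a_i - 1] from each gamma density. Subtraction
   is truncated, so [a_i < b_i] matters. *)
have kE : (b1 + b2 - (a1 + a2) + 2 - 1 =
  3 + ((b1 - a1 - 1) + (b2 - a2 - 1)))%N by clear -ab1 ab2; lia.
case: th => m1 m2 s1 s2 [/= s10 s12]; case: z => z1 [z2 z3] /= z10 z20 z30.
have s20 : 0 < s2 by exact: lt_le_trans s12.
set k := (b1 + b2 - (a1 + a2) + 2)%N.
set l := _ / s1.
have l0 : 0 < l by rewrite divr_gt0 ?ratio_rate_gt0.
pose o1 v := ordstat_pdf n1 a1 m1 s1 (v * z2).
pose o2 v := ordstat_pdf n2 a2 m2 s2 (v * z3).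
pose x1 v := expR ((n1 - a1 + 1)%:R * (v * z2 / s1)).
pose x2 v := expR ((n2 - a2 + 1)%:R * (v * z3 / s1)).
pose e0 v := expR (v * z1 * (s1^-1 - s2^-1)).
pose D1 := ((b1 - a1 - 1)`!%:R * s1 ^+ (b1 - a1)).
pose D2 := ((b2 - a2 - 1)`!%:R * s2 ^+ (b2 - a2)).
have D10 : 0 < D1 by rewrite mulr_gt0 ?ltr0n ?fact_gt0// exprn_gt0.
have D20 : 0 < D2 by rewrite mulr_gt0 ?ltr0n ?fact_gt0// exprn_gt0.
(* [C] undoes the constants of the gamma density of shape [k] and supplies those of [V_1] and [V_2],
   including the power of [z1]. *)
pose C := (k - 1)`!%:R / (l ^+ (k - 1) * D1 * D2) * z1 ^+ (b2 - a2 - 1).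
have C0 : 0 < C.
  apply: mulr_gt0; last exact: exprn_gt0.
  apply: divr_gt0; first by rewrite ltr0n fact_gt0.
  by apply: mulr_gt0 => //; apply: mulr_gt0 => //; exact: exprn_gt0.
have o10 v : 0 <= o1 v by exact: ordstat_pdf_ge0.
have o20 v : 0 <= o2 v by exact: ordstat_pdf_ge0.
exists (fun v => C * (e0 v * ((o1 v * x1 v) * (o2 v * x2 v)))); split.
- move=> v; have [v0|v0] := leP v 0.
    rewrite /ratio_kernel {1}/gamma_pdf [in RHS]/gamma_pdf pmulr_rgt0//.
    by rewrite ltNge v0/= mul0r !mulr0.
  rewrite /ratio_kernel /= -/(o1 v) -/(o2 v) /gamma_pdf.
  rewrite v0 (mulr_gt0 v0 z10) (mulr_gt0 l0 v0) expr1n -/D1 -/D2.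
  have eE : expR (- (v / s1)) * expR (- (v * z1 / s2)) =
      e0 v * (x1 v * x2 v) * expR (- (l * v / 1)).
    rewrite -!expRD; congr expR; rewrite /l /ratio_rate /=.
    by field; rewrite !gt_eqF.
  have -> : (l * v) ^+ (k - 1) =
      l ^+ (k - 1) * (v ^+ 3 * (v ^+ (b1 - a1 - 1) * v ^+ (b2 - a2 - 1))).
    by rewrite exprMn; congr (_ * _); rewrite /k kE !exprD.
  rewrite exprMn /C.
  transitivity (v ^+ 3 * v ^+ (b1 - a1 - 1) * v ^+ (b2 - a2 - 1) *
      z1 ^+ (b2 - a2 - 1) / (D1 * D2) * (o1 v * o2 v) *
      (expR (- (v / s1)) * expR (- (v * z1 / s2)))).
    by field; rewrite !gt_eqF.
  have f0 : (k - 1)`!%:R != 0 :> R by rewrite pnatr_eq0 -lt0n fact_gt0.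
  have lk0 : l ^+ (k - 1) != 0 by rewrite gt_eqF ?exprn_gt0.
  rewrite eE; move: ((k - 1)`!%:R : R) (l ^+ (k - 1)) f0 lk0 => F lk f0 lk0.
  by field; rewrite f0 lk0 !gt_eqF.
- move=> v v0; apply: mulr_ge0; first exact: ltW.
  apply: mulr_ge0; first exact: expR_ge0.
  by apply: mulr_ge0; apply: mulr_ge0 => //; exact: expR_ge0.
- move=> v w v0 vw; rewrite ler_pM2l//; apply: ler_pM.
  + exact: expR_ge0.
  + by apply: mulr_ge0; apply: mulr_ge0 => //; exact: expR_ge0.
  + rewrite ler_expR; apply: ler_wpM2r; first by rewrite subr_ge0 lef_pV2.
    by rewrite ler_pM2r.
  + apply: ler_pM.
    * by apply: mulr_ge0 => //; exact: expR_ge0.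
    * by apply: mulr_ge0 => //; exact: expR_ge0.
    * exact: ordstat_pdf_tilt_homo.
    * exact: ordstat_pdf_tilt_homo.
- move=> /= m10 m20 v v0; apply: mulr_gt0 => //; apply: mulr_gt0.
    exact: expR_gt0.
  apply: mulr_gt0; (apply: mulr_gt0; last exact: expR_gt0);
    apply: ordstat_pdf_gt0 => //.
  + by rewrite (le_lt_trans m10)// mulr_gt0.
  + by rewrite (le_lt_trans m20)// mulr_gt0.
Qed.

(** * The improved factor and its conditional risk *)

(** [ratio_rate] tends to 1 as [z] tends to 0, so [beta2 < c01] leaves room for a small cube at the
    origin on which the estimator really changes. *)
Lemma ratio_rate_region (R : realType) (n1 a1 n2 a2 : nat) (c01 beta2 : R) :
  0 < beta2 -> beta2 < c01 ->
  exists2 B : set (measurableTypeR R * (measurableTypeR R * measurableTypeR R)),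
  measurable B /\ (0 < leb3 B)%E &
  forall z, B z -> [/\ 0 < z.1 :> R, 0 < z.2.1 :> R, 0 < z.2.2 :> R &
    beta2 * ratio_rate n1 a1 n2 a2 z < c01].
Proof.
move=> beta2_gt0 hlt.
pose q : R := 1 + (n1 - a1 + 1)%:R + (n2 - a2 + 1)%:R.
have q0 : 0 < q by rewrite /q -addrA ltr_pwDl ?addr_ge0 ?ler0n.
(* [q] sums the coefficients of the ratios, and [eps] solves [beta2 * (1 + eps * q) = c01], the
   value at the far corner of the cube. *)
pose eps := (c01 - beta2) / (beta2 * q).
have eps0 : 0 < eps by rewrite divr_gt0 ?subr_gt0 ?mulr_gt0.
pose A : set (measurableTypeR R) := [set` `]0, eps[].
have mA : measurable A by exact: measurable_itv.
have lA : (0 < leb A)%E.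
  by rewrite /leb /= lebesgue_measure_itv/= lte_fin eps0 -EFinB subr0 lte_fin.
exists (A `*` (A `*` A)).
  split; first by do 2!apply: measurableX => //.
  have -> : leb3 (A `*` (A `*` A)) = (leb A * (leb A * leb A))%E.
    by rewrite sigma_finite_prodE ?sigma_finite_prodE//; exact: measurableX.
  by rewrite !mule_gt0.
move=> [z1 [z2 z3]] [/= + [/= + +]].
rewrite /A /= !in_itv/= => /andP[z10 z1e] /andP[z20 z2e] /andP[z30 z3e].
split => //; rewrite /ratio_rate /=.
have -> : c01 = beta2 * (1 + eps * q).
  by rewrite /eps; field; rewrite !gt_eqF.
rewrite ltr_pM2l// /q !mulrDr mulr1 !addrA.
rewrite ltr_leD//; last by rewrite mulrC ler_wpM2r// ltW.
rewrite ltr_leD//; last by rewrite mulrC ler_wpM2r// ltW.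
by rewrite ltrD2l.
Qed.

Section stein_estimator.
Context {R : realType}.
Let RR : measurableType _ := measurableTypeR R.
Variables (n1 a1 b1 n2 a2 b2 : nat) (L : R -> R) (c01 beta2 : R).
Hypotheses (ab1 : (a1 < b1)%N) (ab2 : (a2 < b2)%N) (hL : bowl_shaped L).
Hypothesis hreg : regular_loss ((b1 + b2) - (a1 + a2) + 2) L.
Hypothesis hbeta2 : unique_pos_root
  (fun c => gamma_mean ((b1 + b2) - (a1 + a2) + 3)
              (fun u => (L^`())%classic (u * c))) beta2.
Hypothesis hlt : beta2 < c01.

Let beta2_gt0 : 0 < beta2. Proof. by case: hbeta2. Qed.

Let c01_gt0 : 0 < c01. Proof. exact: lt_trans hlt. Qed.

Definition stein_factor (z : RR * (RR * RR)) : R :=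
  if [&& 0 < (z.1 : R), 0 < (z.2.1 : R) & 0 < (z.2.2 : R)] then
    Num.min c01 (beta2 * ratio_rate n1 a1 n2 a2 z)
  else c01.

Lemma stein_factor_gt0 z : 0 < stein_factor z.
Proof.
rewrite /stein_factor; case: ifPn => // /and3P[z1 z2 z3].
by rewrite lt_min c01_gt0 mulr_gt0// ratio_rate_gt0.
Qed.

Lemma measurable_stein_factor : measurable_fun setT stein_factor.
Proof.
have m1 : measurable_fun setT (fun z : RR * (RR * RR) => z.1 : R).
  exact: measurable_fst.
have m2 : measurable_fun setT (fun z : RR * (RR * RR) => z.2.1 : R).
  by apply: (measurableT_comp measurable_fst); exact: measurable_snd.
have m3 : measurable_fun setT (fun z : RR * (RR * RR) => z.2.2 : R).
  by apply: (measurableT_comp measurable_snd); exact: measurable_snd.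
apply: measurable_fun_ifT => //.
- apply: measurable_and; first exact: measurable_fun_ltr.
  by apply: measurable_and; exact: measurable_fun_ltr.
- apply: measurable_minr => //; apply: measurable_funM => //.
  apply: measurable_funD; last exact: measurable_funM.
  apply: measurable_funD; last exact: measurable_funM.
  exact: measurable_funD.
Qed.

Local Notation integrand th phi :=
  (ratio_integrand n1 a1 b1 n2 a2 b2 L th phi).

(** In the variable [S * v / sigma1], with [S] the rate, the factors [beta2 * S] and [c01] become
    [beta2] and [c01 / S]; both now multiply a variable with a weighted standard gamma kernel, and
    [beta2 < c01 / S]. *)
Lemma stein_factor_improves (th : param R) (z : RR * (RR * RR)) :
  admissible th ->
  0 < z.1 :> R -> 0 < z.2.1 :> R -> 0 < z.2.2 :> R ->
  beta2 * ratio_rate n1 a1 n2 a2 z < c01 ->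
  (\int[leb]_v integrand th stein_factor (v, z) <=
   \int[leb]_v integrand th (cst c01) (v, z))%E /\
  (mu1 th <= 0 -> mu2 th <= 0 ->
   (\int[leb]_v integrand th (cst c01) (v, z) < +oo)%E ->
   (\int[leb]_v integrand th stein_factor (v, z) <
    \int[leb]_v integrand th (cst c01) (v, z))%E).
Proof.
move=> hth z1 z2 z3 hS.
have s10 : 0 < sigma1 th by case: hth.
pose S := ratio_rate n1 a1 n2 a2 z.
have S0 : 0 < S by exact: ratio_rate_gt0.
have [H [KE H0 Hh Hgt0]] :=
  ratio_kernel_weight n1 a1 b1 n2 a2 b2 th z ab1 ab2 hth z1 z2 z3.
have ee : beta2 < c01 / S by rewrite ltr_pdivlMr.
have e0 : 0 < c01 / S by rewrite divr_gt0.
have l0 : 0 < S / sigma1 th by rewrite divr_gt0.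
have k0 : (0 < b1 + b2 - (a1 + a2) + 2)%N by rewrite addn2.
have [ib _ _] := hreg beta2 beta2_gt0.
have [ie _ _] := hreg (c01 / S) e0.
have Qlt : gamma_mean (b1 + b2 - (a1 + a2) + 2) (fun x => L (beta2 * x)) <
    gamma_mean (b1 + b2 - (a1 + a2) + 2) (fun x => L (c01 / S * x)).
  by apply: gamma_mean_loss_lt => //; rewrite -addnS.
have mK := measurable_ratio_kernel n1 a1 b1 n2 a2 b2 th z.
have E1 : (\int[leb]_v integrand th stein_factor (v, z) =
    \int[leb]_v ((pos_loss L (beta2 * (S / sigma1 th * v)))%:E *
      (ratio_kernel n1 a1 b1 n2 a2 b2 th z v)%:E))%E.
  apply: eq_integral => v _.
  rewrite /ratio_integrand /= /stein_factor z1 z2 z3/=.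
  by rewrite min_r ?ltW// -/S; congr (pos_loss _ _ * _)%:E; ring.
have E2 : (\int[leb]_v integrand th (cst c01) (v, z) =
    \int[leb]_v ((pos_loss L (c01 / S * (S / sigma1 th * v)))%:E *
      (ratio_kernel n1 a1 b1 n2 a2 b2 th z v)%:E))%E.
  apply: eq_integral => v _; rewrite /ratio_integrand /=.
  by congr (pos_loss _ _ * _)%:E; field; rewrite !gt_eqF.
rewrite E1 E2; split.
  exact: (weighted_loss_le hL _ _ _ _ H beta2_gt0 ee l0 ib ie Qlt mK KE H0 Hh).
move=> m1 m2 Joo.
apply: (weighted_loss_lt hL _ _ _ _ H beta2_gt0 ee l0 ib ie Qlt mK KE H0 Hh)
  => //.
exact: Hgt0.
Qed.

(** The factor differs from [c01] only for positive ratios with [beta2 * ratio_rate < c01]; for all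
    other ratios the two integrals coincide. *)
Lemma stein_factor_le (th : param R) (z : RR * (RR * RR)) :
  admissible th ->
  (\int[leb]_v integrand th stein_factor (v, z) <=
   \int[leb]_v integrand th (cst c01) (v, z))%E.
Proof.
move=> hth; have [phiE|] := eqVneq (stein_factor z) c01.
  by rewrite le_eqVlt; apply/orP; left; apply/eqP; apply: eq_integral => v _;
    rewrite /ratio_integrand /= phiE.
rewrite {1}/stein_factor; case: ifPn => [/and3P[z1 z2 z3]|];
  last by rewrite eqxx.
have [cS|Sc _] := leP c01 (beta2 * ratio_rate n1 a1 n2 a2 z).
  by rewrite eqxx.
by have [] := stein_factor_improves th z hth z1 z2 z3 Sc.
Qed.

End stein_estimator.

(** * Dominance over the best affine equivariant estimator *)

Theorem corollary2p6 (R : realType) (d : measure_display)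
    (T : measurableType d)
    (n1 a1 b1 n2 a2 b2 : nat)
    (ha1 : (1 <= a1)%N) (hab1 : (a1 < b1)%N) (hbn1 : (b1 <= n1)%N)
    (ha2 : (1 <= a2)%N) (hab2 : (a2 < b2)%N) (hbn2 : (b2 <= n2)%N)
    (P : param R -> probability T R) (X1 X2 V1 V2 : {mfun T >-> R})
    (hmodel : censored_model n1 a1 b1 n2 a2 b2 P X1 X2 V1 V2)
    (L : R -> R) (hL : bowl_shaped L)
    (hreg1 : regular_loss (b1 - a1) L)
    (hreg2 : regular_loss ((b1 + b2) - (a1 + a2) + 2) L)
    (c01 beta2 : R)
    (hc01 : unique_pos_root
       (fun c => gamma_mean (b1 - a1) (fun v => (L^`())%classic (c * v) * v)) c01)
    (hbeta2 : unique_pos_root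
       (fun c => gamma_mean ((b1 + b2) - (a1 + a2) + 3)
                   (fun u => (L^`())%classic (u * c))) beta2)
    (hlt : beta2 < c01) :
  dominates P L (delta1S3 n1 a1 n2 a2 c01 beta2 X1 X2 V1 V2)
    (delta01 c01 V1).
Proof.
have c010 : 0 < c01 by case: hc01.
have beta20 : 0 < beta2 by case: hbeta2.
pose phi := stein_factor n1 a1 n2 a2 c01 beta2.
have phi0 z : 0 < phi z by exact: stein_factor_gt0 hbeta2 hlt z.
have mphi : measurable_fun setT phi by exact: measurable_stein_factor.
have deltaE w : delta1S3 n1 a1 n2 a2 c01 beta2 X1 X2 V1 V2 w =
    phi (V2 w / V1 w, (X1 w / V1 w, X2 w / V1 w)) * V1 w.
  by rewrite /delta1S3 /phi /stein_factor /ratio_rate /=; case: ifP.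
have mdelta : measurable_fun setT (delta1S3 n1 a1 n2 a2 c01 beta2 X1 X2 V1 V2).
  rewrite (funext deltaE); apply: measurable_funM => //.
  have mV : measurable_fun setT (fun w => (V1 w)^-1).
    by apply: (measurableT_comp (measurable_invr _)).
  apply: (measurableT_comp mphi); apply: measurable_fun_pair.
    exact: (measurable_funM (measurable_funP V2) mV).
  apply: measurable_fun_pair.
    exact: (measurable_funM (measurable_funP X1) mV).
  exact: (measurable_funM (measurable_funP X2) mV).
have mdelta0 : measurable_fun setT (delta01 c01 V1).
  exact: measurable_funM.
have riskE th : admissible th ->
    risk P L th (delta1S3 n1 a1 n2 a2 c01 beta2 X1 X2 V1 V2) =
    (\int[leb3]_z \int[leb]_v
      ratio_integrand n1 a1 b1 n2 a2 b2 L th phi (v, z))%E.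
  by move=> hth; apply: (risk_equivariant _ _ _ _ _ _ P X1 X2 V1 V2 hmodel).
have risk0E th : admissible th -> risk P L th (delta01 c01 V1) =
    (\int[leb3]_z \int[leb]_v
      ratio_integrand n1 a1 b1 n2 a2 b2 L th (cst c01) (v, z))%E.
  by move=> hth; apply: (risk_equivariant _ _ _ _ _ _ P X1 X2 V1 V2 hmodel).
have mI th psi : admissible th -> measurable_fun setT psi -> measurable_fun setT
    (fun z => \int[leb]_v ratio_integrand n1 a1 b1 n2 a2 b2 L th psi (v, z))%E.
  move=> hth mpsi.
  apply: (@measurable_fun_fubini_tonelli_G _ _ _ _ _ leb
    (ratio_integrand n1 a1 b1 n2 a2 b2 L th psi)).
    exact: measurable_ratio_integrand.
  exact: ratio_integrand_ge0.
have I0 th psi z : admissible th ->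
    (0 <= \int[leb]_v ratio_integrand n1 a1 b1 n2 a2 b2 L th psi (v, z))%E.
  by move=> hth; apply: integral_ge0 => v _; exact: ratio_integrand_ge0.
split.
  move=> th hth; rewrite (riskE th hth) (risk0E th hth); apply: ge0_le_integral.
  - exact: measurableT.
  - by move=> z _; exact: I0.
  - exact: mI.
  - exact: mI.
  - by move=> z _; exact: stein_factor_le.
(* Zero locations make the weight [H] positive, and [sigma1 = 1] turns the risk of [c01 * V1] into
   the mean of [L (c01 * W)] with [W] of law Gamma([b1 - a1], 1), finite by [hreg1]. *)
pose th := @Param R 0 0 1 1.
have hth : admissible th by split; rewrite /= ?ltr01.
exists th => //.
have fin : (risk P L th (delta01 c01 V1) < +oo)%E.
  have [_ _ hV1 _ _] := hmodel th hth.
  have lawV := has_density_law _ _ _ _ V1 _ (measurable_gamma_pdf _ _ _)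
    (fun x => gamma_pdf_ge0 _ (b1 - a1) _ x (@ltr01 R)) hV1.
  rewrite (risk_pos_loss _ _ _ _ _ _ P X1 X2 V1 V2 hmodel)//; last first.
    by move=> w V10; rewrite mulr_gt0.
  rewrite (lawV (fun x => (pos_loss L (c01 * x / 1))%:E)); last 2 first.
  - apply/measurable_EFinP; apply: (measurableT_comp (measurable_pos_loss hL)).
    by apply: measurable_funM => //; exact: mulrl_measurable.
  - by move=> x; rewrite lee_fin pos_loss_ge0.
  have [/gamma_integrableT i _ _] := hreg1 c01 c010.
  apply: le_lt_trans (integrable_lty measurableT i).
  rewrite le_eqVlt; apply/orP; left; apply/eqP; apply: eq_integral => x _.
  rewrite divr1 -EFinM; have [x0|x0] := leP (x : R) 0.
    by rewrite /gamma_pdf [(0 < x)%R]ltNge x0/= !mulr0.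
  by rewrite /pos_loss pmulr_rgt0// x0.
move: fin; rewrite (risk0E th hth) (riskE th hth) => fin.
have [B [mB B0] hB] := ratio_rate_region R n1 a1 n2 a2 c01 beta2 beta20 hlt.
apply: (ge0_lt_integral _ _ _ leb3 _ _ B) => //.
- exact: mI.
- exact: mI.
- by move=> z; exact: I0.
- by move=> z; exact: stein_factor_le.
- move=> z /hB[z1 z2 z3 Sc].
  have [_] := stein_factor_improves n1 a1 b1 n2 a2 b2 L c01 beta2 hab1 hab2 hL
    hreg2 hbeta2 hlt th z hth z1 z2 z3 Sc.
  by apply.
Qed.
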